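(* Let $t=\frac{\sqrt{2}}{2}\,e^{\frac{2i\pi}{3}}$ and let $\mathcal{G}$ be the subgroup of $SU(3)$ generated by the two matrices $$G_1=e^{\frac{i\pi}{9}}\begin{pmatrix} 2\bar{t}^2&0&0\\0&2t^2&0\\0&0&-2\bar{t}^2\end{pmatrix},\qquad G_2=e^{\frac{i\pi}{9}}\begin{pmatrix} t^2&t&-t^2\\ t&0&t\\ -t^2&t&t^2\end{pmatrix}.$$ Then the following hold. (1) $G_1$ and $G_2$ have the same eigenvalues, $G_2$ is unitarily similar to the diagonal matrix $\mathrm{diag}\bigl(e^{\frac{7i\pi}{9}},\,-e^{\frac{4i\pi}{9}},\,e^{-\frac{2i\pi}{9}}\bigr)$, and both $G_1$ and $G_2$ have order $18$. (2) Up to the phase $e^{\frac{i\pi}{9}}$, $G_1$ and $G_2$ are the matrices obtained by braiding anyons $1$ and $2$, respectively anyons $2$ and $3$, in the space of fusion trees of four anyons of topological charge $2$ with total charge $0$ in the Jones-Kauffman theory at level $4$, with unitary normalization. That is, with the space $V_{4,2,0}$, its orthonormal basis $(e_0,e_2,e_4)$ and the braiding operators $\rho(g_1),\rho(g_2)$ defined in the context, the matrices of $\rho(g_1)$ and $\rho(g_2)$ in the ordered basis $(e_0,e_2,e_4)$ are $e^{-\frac{i\pi}{9}}G_1$ and $e^{-\frac{i\pi}{9}}G_2$ respectively. (3) $G_1G_2G_1=G_2G_1G_2$ and $G_1^2\,G_2^2=G_2^2\,G_1^2$. (4) Put $D=\mathrm{diag}(-1,-1,1)$, $$\mathcal{N}=\langle\,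 G_1G_2^2G_1^{-1},\; G_1G_2^{-2}G_1\,\rangle,$$ $$\mathcal{H}=\{\, I,\; D,\; G_1G_2G_1,\; D\,G_1G_2G_1\,D,\; G_1G_2G_1\,D,\; D\,G_1G_2G_1\,\}.$$ Then $\mathcal{N}$ is a normal subgroup of $\mathcal{G}$ with $\mathcal{N}\simeq\mathbb{Z}_9\times\mathbb{Z}_3$, $\mathcal{H}$ is a subgroup of $\mathcal{G}$ with $\mathcal{H}\simeq S_3$, and $\mathcal{G}=\mathcal{N}\rtimes_{\phi}\mathcal{H}$ (internal semidirect product, i.e. $(N,H)\mapsto NH$ is a group isomorphism from $\mathcal{N}\rtimes_\phi\mathcal{H}$ onto $\mathcal{G}$), where for each $H\in\mathcal{H}$, $\phi(H)$ is the automorphism $N\mapsto HNH^{-1}$ of $\mathcal{N}$. (5) $\mathcal{G}$ is isomorphic to the group $D(9,1,1;2,1,1)$.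
   Context: The bar denotes complex conjugation, $I$ is the $3\times 3$ identity matrix, $\langle\cdot\rangle$ denotes the generated subgroup, $\mathbb{Z}_n$ is the cyclic group of order $n$, and $S_3$ is the symmetric group on three letters. **The groups $D(n,a,b;d,r,s)$.** For positive integers $n,d$ and integers $0\le a,b\le n-1$, $0\le r,s\le d-1$, $D(n,a,b;d,r,s)$ is the subgroup of $SU(3)$ generated by the three matrices $$E=\begin{pmatrix}0&1&0\\0&0&1\\1&0&0\end{pmatrix},\quad F(n,a,b)=\begin{pmatrix}e^{\frac{2ia\pi}{n}}&0&0\\0&e^{\frac{2ib\pi}{n}}&0\\0&0&e^{\frac{2i(-a-b)\pi}{n}}\end{pmatrix},\quad \begin{pmatrix} e^{\frac{2ir\pi}{d}}&0&0\\0&0&e^{\frac{2is\pi}{d}}\\0&-e^{\frac{2i(-r-s)\pi}{d}}&0\end{pmatrix}.$$ **The braiding operators (Jones-Kauffman theory at level $4$).** Let $\mathsf{A}=i\,e^{-\frac{i\pi}{12}}$ be the Kauffman variable and $\delta=-\mathsf{A}^2-\mathsf{A}^{-2}=\sqrt{3}$ the loop value. Let $\Delta_{-1}=0$, $\Delta_0=1$, $\Delta_{n+1}=\delta\Delta_n-\Delta_{n-1}$. Let $f_n$ denote the Jones-Wenzl projector on $n$ strands in the Temperley-Lieb algebra with loop value $\delta$: $f_1=1$, $f_{n+1}=(f_n\otimes 1)-\frac{\Delta_{n-1}}{\Delta_n}(f_n\otimes 1)\,u_n\,(f_n\otimes 1)$, where $u_n$ is the $n$-th cup-cap generator; these exist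 for $n\le 4$. Let $M_8$ be the complex vector space with basis the crossingless matchings of $8$ points on a horizontal line, drawn in the lower half-plane. The Temperley-Lieb algebra on $8$ strands acts on $M_8$ by stacking on top, closed loops being replaced by $\delta$; let $u_1,\dots,u_7$ be its cup-cap generators. Set $V_{4,2,0}=(f_2\otimes f_2\otimes f_2\otimes f_2)M_8$; the pairs of points $(1,2),(3,4),(5,6),(7,8)$ are the four anyons $1,2,3,4$, each of charge $2$. Equip $M_8$ with the sesquilinear form for which the pairing of two matchings is $\delta^{\ell}$, where $\ell$ is the number of closed loops obtained by gluing the mirror image of one on top of the other. For $\alpha\in\{0,2,4\}$ let $v_\alpha\in V_{4,2,0}$ be the fusion tree in which anyons $1$ and $2$ fuse to $\alpha$, anyons $3$ and $4$ fuse to $\alpha$, and the two charges $\alpha$ fuse to $0$. Explicitly, $v_\alpha$ is the planar diagram with $f_2$ placed on each anyon, with $2-\frac{\alpha}{2}$ parallel arcs joining anyon $1$ to anyon $2$, $2-\frac{\alpha}{2}$ parallel arcs joining anyon $3$ to anyon $4$, and a bundle of $\alpha$ strands carrying $f_\alpha$, of which $\frac{\alpha}{2}$ end at each of anyons $1$ and $2$ at one end of the bundle and $\frac{\alpha}{2}$ end at each of anyons $3$ and $4$ at the other end. Let $e_\alpha=v_\alpha/\sqrt{\langle v_\alpha,v_\alpha\rangle}$. The vectors $e_0,e_2,e_4$ form an orthonormal basis of $V_{4,2,0}$. Put $\sigma_j=\mathsf{A}\cdot 1+\mathsf{A}^{-1}u_j$ for $1\le j\le 7$ (Kauffman bracket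 resolution of a crossing). The braid group generator $g_i$ of $B_4$ ($i=1,2,3$), which braids anyons $i$ and $i+1$, acts on $V_{4,2,0}$ by the two-strand cabled crossing $\rho(g_i)=\sigma_{2i}\,\sigma_{2i-1}\,\sigma_{2i+1}\,\sigma_{2i}$. *)

(* Defs.v *)
From HB Require Import structures.
From mathcomp Require Import all_boot all_order all_algebra all_fingroup.
From mathcomp Require Import spectral mxred complex.
From mathcomp Require Import all_classical all_reals all_analysis.

Set Implicit Arguments.
Unset Strict Implicit.
Unset Printing Implicit Defensive.

Import Order.TTheory GRing.Theory Num.Theory.
Local Open Scope classical_set_scope.
Local Open Scope ring_scope.

Definition expi (R : realType) (x : R) : R[i] := Complex (cos x) (sin x).

Definition mx3 (R : realType) (rows : seq (seq R[i])) : 'M[R[i]]_3 :=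
  \matrix_(i < 3, j < 3) nth 0 (nth [::] rows i) j.

Definition diag3 (R : realType) (a b c : R[i]) : 'M[R[i]]_3 :=
  mx3 [:: [:: a; 0; 0]; [:: 0; b; 0]; [:: 0; 0; c]].

(** * Groups of invertible matrices *)

Definition SU3 (R : realType) : set 'M[R[i]]_3 :=
  [set A | A \is unitarymx /\ \det A = 1].
Arguments SU3 : clear implicits.

(* Only used for sets of invertible elements: on a non-unit, [x^-1] is [x]. *)
Definition is_subgroup (T : unitRingType) (K : set T) : Prop :=
  [/\ K 1, (forall x y, K x -> K y -> K (x * y))
    & (forall x, K x -> K x^-1)].

Definition generated (T : unitRingType) (S : set T) : set T :=
  smallest (@is_subgroup T) S.

Definition is_normal_subgroup (T : unitRingType) (G N : set T) : Prop :=
  [/\ is_subgroup N, N `<=` G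
    & forall x y, G x -> N y -> N (x * y * x^-1)].

Definition is_group_isom (T U : Type) (opT : T -> T -> T) (opU : U -> U -> U)
    (A : set T) (B : set U) (f : T -> U) : Prop :=
  set_bij A B f /\
  (forall x y, A x -> A y -> f (opT x y) = opU (f x) (f y)).

Definition group_isomorphic (T U : Type) (opT : T -> T -> T)
    (opU : U -> U -> U) (A : set T) (B : set U) : Prop :=
  exists f : T -> U, is_group_isom opT opU A B f.

Definition has_order (T : unitRingType) (x : T) (n : nat) : Prop :=
  [/\ (0 < n)%N, x ^+ n = 1 & forall m, (0 < m < n)%N -> x ^+ m <> 1].

Definition semidirect_mul (T : unitRingType) (phi : T -> T -> T)
    (x y : T * T) : T * T := (x.1 * phi x.2 y.1, x.2 * y.2).

(* [G] is the internal semidirect product of [N] and [H] with respect to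
   the action [phi] of [H] on [N]. *)
Definition is_semidirect_product (T : unitRingType) (G N H : set T)
    (phi : T -> T -> T) : Prop :=
  [/\ forall h, H h -> is_group_isom *%R *%R N N (phi h),
      forall h k x, H h -> H k -> N x -> phi (h * k) x = phi h (phi k x)
    & is_group_isom (semidirect_mul phi) *%R (N `*` H) G
        (fun x => x.1 * x.2)].

(** * The groups D(n,a,b;d,r,s) *)

Definition D_E (R : realType) : 'M[R[i]]_3 :=
  mx3 [:: [:: 0; 1; 0]; [:: 0; 0; 1]; [:: 1; 0; 0]].

Definition D_F (R : realType) (n a b : nat) : 'M[R[i]]_3 :=
  diag3 (expi (2 * a%:R * pi / n%:R)) (expi (2 * b%:R * pi / n%:R))
        (expi (2 * (- a%:R - b%:R) * pi / n%:R)).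

Definition D_G (R : realType) (d r s : nat) : 'M[R[i]]_3 :=
  mx3 [:: [:: expi (2 * r%:R * pi / d%:R); 0; 0];
          [:: 0; 0; expi (2 * s%:R * pi / d%:R)];
          [:: 0; - expi (2 * (- r%:R - s%:R) * pi / d%:R); 0]].

Definition D_group (R : realType) (n a b d r s : nat) : set 'M[R[i]]_3 :=
  generated [set D_E R; D_F R n a b; D_G R d r s].
Arguments D_group : clear implicits.

(** * The matrices G_1, G_2 and the groups they define *)

Definition tpar (R : realType) : R[i] :=
  (Num.sqrt 2 / 2)%:C%C * expi (2 * pi / 3).

Definition G1 (R : realType) : 'M[R[i]]_3 :=
  let t := tpar R in
  expi (pi / 9) *: diag3 (2 * t^* ^+ 2) (2 * t ^+ 2) (- (2 * t^* ^+ 2)).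

Definition G2 (R : realType) : 'M[R[i]]_3 :=
  let t := tpar R in
  expi (pi / 9) *: mx3 [:: [:: t ^+ 2; t; - t ^+ 2];
                           [:: t; 0; t];
                           [:: - t ^+ 2; t; t ^+ 2]].

Definition groupG (R : realType) : set 'M[R[i]]_3 := generated [set G1 R; G2 R].
Arguments groupG : clear implicits.

Definition matD (R : realType) : 'M[R[i]]_3 := diag3 (-1) (-1) 1.

Definition groupN (R : realType) : set 'M[R[i]]_3 :=
  generated [set G1 R * G2 R ^+ 2 * (G1 R)^-1; G1 R * G2 R ^- 2 * G1 R].
Arguments groupN : clear implicits.

Definition setH (R : realType) : set 'M[R[i]]_3 :=
  let D := matD R in let W := G1 R * G2 R * G1 R in
  [set 1; D; W; D * W * D; W * D; D * W].
Arguments setH : clear implicits.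

(** * Crossingless matchings and the Temperley-Lieb action *)

(* A matching of n points on a line, numbered from 0, is given by its partner
   function. Drawn in a half-plane, the arcs {i, m i} and {j, m j} cross
   exactly when i < j < m i < m j up to renaming. *)
Definition crossingless n (m : {ffun 'I_n -> 'I_n}) : bool :=
  [forall i, (m i != i) && (m (m i) == i)] &&
  [forall i : 'I_n, forall j : 'I_n, ~~ [&& i < j, j < m i & m i < m j]%N].

Definition matching (n : nat) := {m : {ffun 'I_n -> 'I_n} | crossingless m}.

Definition partner n (m : matching n) (k : nat) : nat :=
  if insub k is Some i then val (val m i : 'I_n) else k.

Definition matching_space (R : realType) (n : nat) :=
  {ffun matching n -> R[i]^o}.

Definition lin_ext (R : realType) n k
    (f : matching n -> matching_space R k) (x : matching_space R n) :
    matching_space R k :=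
  \sum_m x m *: f m.

(* The basis vector of the crossingless matching of n points whose partner
   function is p. The value is 0 if there is no such matching, which does not
   happen for the functions p used below: stacking a cup-cap and inserting an
   arc preserve crossingless matchings. *)
Definition basis_vec (R : realType) n (p : nat -> nat) : matching_space R n :=
  [ffun m => [forall i : 'I_n, partner m i == p i]%:R].

(* The Kauffman variable. *)
Definition Akauf (R : realType) : R[i] := 'i%C * expi (- pi / 12).

Definition delta (R : realType) : R[i] := - Akauf R ^+ 2 - Akauf R ^- 2.

(* As Delta_(-1) = 0, the recursion gives Delta_1 = delta. *)
Fixpoint Delta (R : realType) (n : nat) : R[i] :=
  match n with
  | 0 => 1
  | 1 => delta R
  | (k.+1 as l).+1 => delta R * Delta R l - Delta R k
  end.

(* Partner function of the matching obtained by stacking the cup-cap on the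
   points a and a.+1 on top of a matching with partner function p that does
   not match a with a.+1: the cap joins the former partners of a, a.+1. *)
Definition cupcap_fun (a : nat) (p : nat -> nat) (i : nat) : nat :=
  if i == a then a.+1 else if i == a.+1 then a
  else if i == p a then p a.+1 else if i == p a.+1 then p a
  else p i.

(* The j-th cup-cap generator, 1 <= j < n, acting by stacking on top; the j-th
   strand ends at the point j.-1. *)
Definition u_ (R : realType) n (j : nat) :
    matching_space R n -> matching_space R n :=
  lin_ext (fun m =>
    if partner m j.-1 == j then delta R *: basis_vec R n (partner m)
    else basis_vec R n (cupcap_fun j.-1 (partner m))).

(* The Jones-Wenzl projector f_n placed on the strands s+1, ..., s+n of N: as a
   polynomial in the cup-cap generators, f_n tensored with 1 is f_n. *)
Fixpoint JW (R : realType) N (s n : nat) (x : matching_space R N) :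
    matching_space R N :=
  match n with
  | 0 | 1 => x
  | (j.+1 as k).+1 =>
      let y := JW s k x in
      y - (Delta R j / Delta R k) *: JW s k (u_ (s + k) y)
  end.

(* Insertion of an arc joining two new adjacent points a, a.+1; the old points
   a, a.+1, ... move to a.+2, a.+3, ... *)
Definition cup_fun (a : nat) (p : nat -> nat) (i : nat) : nat :=
  if i == a then a.+1 else if i == a.+1 then a
  else bump a (bump a (p (unbump a (unbump a i)))).

Definition cup (R : realType) n (a : nat) :
    matching_space R n -> matching_space R n.+2 :=
  lin_ext (fun m => basis_vec R n.+2 (cup_fun a (partner m))).

Definition empty_matching (R : realType) : matching_space R 0 :=
  basis_vec R 0 id.

(* Gluing the mirror image of one matching on the other gives a graph whose
   connected components are the closed loops. *)
Definition loops n (a b : matching n) : nat :=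
  n_comp [rel i j | (j == val a i) || (j == val b i)] predT.

Definition pairing (R : realType) n (x y : matching_space R n) : R[i] :=
  \sum_a \sum_b (x a)^* * y b * delta R ^+ loops a b.

(** * Four anyons of charge 2 with total charge 0 *)

Definition f2222 (R : realType) (x : matching_space R 8) : matching_space R 8 :=
  JW 0 2 (JW 2 2 (JW 4 2 (JW 6 2 x))).

Definition V420 (R : realType) : set (matching_space R 8) := range (@f2222 R).
Arguments V420 : clear implicits.

(* The bundle of alpha strands is the nest of alpha arcs on 2 alpha points, with
   f_alpha on its left end (nothing for alpha = 0); the arcs joining anyons 1 and 2 are then inserted
   in the middle of that left end, those joining anyons 3 and 4 in the middle of
   the right end. *)
Definition v0 (R : realType) : matching_space R 8 :=
  f2222 (cup 5 (cup 4 (cup 1 (cup 0 (empty_matching R))))).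

Definition v2 (R : realType) : matching_space R 8 :=
  f2222 (cup 5 (cup 1 (JW 0 2 (cup 1 (cup 0 (empty_matching R)))))).

Definition v4 (R : realType) : matching_space R 8 :=
  f2222 (JW 0 4 (cup 3 (cup 2 (cup 1 (cup 0 (empty_matching R)))))).

Definition normalize (R : realType) n (v : matching_space R n) :
    matching_space R n :=
  (sqrtC (pairing v v))^-1 *: v.

(* (e_0, e_2, e_4) *)
Definition ebasis (R : realType) (i : 'I_3) : matching_space R 8 :=
  normalize (nth 0 [:: v0 R; v2 R; v4 R] i).

Definition orthonormal_basis (R : realType) n k (V : set (matching_space R n))
    (e : 'I_k -> matching_space R n) : Prop :=
  [/\ forall i, V (e i),
      forall i j, pairing (e i) (e j) = (i == j)%:R
    & forall x, V x -> exists c : 'I_k -> R[i], x = \sum_i c i *: e i].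

Definition matrix_in_basis (R : realType) n k
    (f : matching_space R n -> matching_space R n)
    (e : 'I_k -> matching_space R n) (M : 'M[R[i]]_k) : Prop :=
  forall j, f (e j) = \sum_i M i j *: e i.

Definition sigma (R : realType) n (j : nat) (x : matching_space R n) :
    matching_space R n :=
  Akauf R *: x + (Akauf R)^-1 *: u_ j x.

Definition rho (R : realType) (i : nat) (x : matching_space R 8) :
    matching_space R 8 :=
  sigma (2 * i) (sigma (2 * i).-1 (sigma (2 * i).+1 (sigma (2 * i) x))).
Arguments rho : clear implicits.

(* Main.v *)
Require Import Defs.
From HB Require Import structures.
From mathcomp Require Import all_boot all_order all_algebra all_fingroup.
From mathcomp Require Import spectral mxred complex.
From mathcomp Require Import all_classical all_reals all_analysis.
From mathcomp Require Import ring lra zify.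

Set Implicit Arguments.
Unset Strict Implicit.
Unset Printing Implicit Defensive.

Import Order.TTheory GRing.Theory Num.Theory.
Local Open Scope classical_set_scope.
Local Open Scope ring_scope.

Local Notation generated := Defs.generated.

(** Two independent arguments prove the theorem, one about the group and one
about the fusion trees.

The group. Let B be the real orthogonal involution with columns
(e_1 + e_3)/sqrt 2, e_2 and (e_1 - e_3)/sqrt 2. Conjugation by B turns G_1 and
G_2 into monomial matrices: with w = e^(2 i pi/9) they become
-diag(w^8, w^2, w^8) P_(13) and -diag(w^8, w^8, w^2) P_(12) ([G1_conjB],
[G2_conjB], [mono1E], [mono2E]). So, in the new coordinates, the group consists
of the matrices sgn(s) diag(w^a, w^b, w^c) P_s, where s is in S_3, the exponents
a, b, c are congruent modulo 3 and 9 divides a + b + c. The diagonal ones form N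
([groupNP]); exponents modulo 9 identify N with Z_9 x Z_3 ([groupN_isom]) and
show that it is stable under permutation of the coordinates, hence normal
([groupN_normal]). The signed permutation matrices sgn(s) P_s form a copy of S_3,
which is H ([setH_range]). A signed permutation matrix that is diagonal is the
identity, so the product of N and H is semidirect, and it contains both
generators ([groupG_semidirect]). The generators of D(9,1,1;2,1,1) are, as they
stand, matrices of the same monomial group, so conjugation by B is the
isomorphism of part (5) ([groupG_D_group]).

The braid relation, read as (G_1 G_2) G_1 = G_2 (G_1 G_2), says that the unitary
matrix G_1 G_2 conjugates G_1 into G_2. As G_1 is the diagonal matrix of part
(1), this gives the spectrum, the diagonalization and the order of G_2.

The fusion trees. The space M_8 has the 14 crossingless matchings as a basis, and
every scalar that occurs lies in the cyclotomic field Q(A), because A is a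
primitive 24th root of unity: A^8 = A^4 - 1, delta = A^6 - 2 A^2,
sqrt 2 = A^5 - A^3 - A and t = (A + A^7)/2. So part (2) is a finite computation
with vectors of 14 elements of Q(A), each of them given by eight rational
numbers. The function [vec] interprets such a vector in M_8 and turns the
operations on coefficients into the operations of the theory ([vec_vu],
[vec_vJW], [vec_vrho], [pairing_vec]); the equations to verify are then equalities
of lists of rational numbers. A matching with an arc inside one of the anyons is
killed by f_2, so at most three matchings survive in V_(4,2,0), and [vcoords]
expresses their images in the basis e_0, e_2, e_4. *)

(** * Roots of unity *)

Section RootsOfUnity.
Variable R : realType.

Lemma expiD (x y : R) : expi (x + y) = expi x * expi y.
Proof. by rewrite /expi cosD sinD [sin x * _ + _]addrC. Qed.

Lemma expi0 : expi (0 : R) = 1.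
Proof. by rewrite /expi cos0 sin0. Qed.

Lemma expi_pi : expi (pi : R) = -1.
Proof. by rewrite /expi cospi sinpi; apply/eqP; rewrite eq_complex /= oppr0 !eqxx. Qed.

Lemma expiMn (x : R) n : expi (n%:R * x) = expi x ^+ n.
Proof.
elim: n => [|n IHn]; first by rewrite mul0r expi0.
by rewrite -natr1 mulrDl mul1r expiD IHn exprSr.
Qed.

Lemma conj_expi (x : R) : (expi x)^* = expi (- x).
Proof. by rewrite /expi cosN sinN. Qed.

Lemma expiNK (x : R) : expi (- x) * expi x = 1.
Proof. by rewrite -expiD addNr expi0. Qed.

(** All the angles that occur are multiples of pi/36, so that every exponential is
a power of this primitive 72nd root of unity. *)
Definition zeta : R[i] := expi (pi / 36).

Lemma expi_zeta n (x : R) : x = n%:R * (pi / 36) -> expi x = zeta ^+ n.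
Proof. by move->; rewrite expiMn. Qed.

Lemma zeta36 : zeta ^+ 36 = -1.
Proof. by rewrite -(@expi_zeta _ pi) ?expi_pi //; field. Qed.

(** This is the 72nd cyclotomic equation, by which [ring] decides all identities
between powers of [zeta]. It comes from zeta^36 + 1 = (zeta^12 + 1) (zeta^24 -
zeta^12 + 1), where the first factor is not 0 because zeta^12 is not real. *)
Lemma zeta24 : zeta ^+ 24 = zeta ^+ 12 - 1.
Proof.
have z12 : zeta ^+ 12 + 1 != 0.
  rewrite -(@expi_zeta _ (pi / 3)) ?addr_eq0; last by field.
  rewrite eq_complex /= oppr0 negb_and; apply/orP; right.
  by rewrite gt_eqF // sin_gt0_pi //; have := pi_gt0 R; lra.
apply: (mulfI z12).
by transitivity (zeta ^+ 36 + zeta ^+ 24); [ring | rewrite zeta36; ring].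
Qed.

Lemma expi_neq0 (x : R) : expi x != 0.
Proof.
by apply/eqP => x0; have /eqP := expiNK x; rewrite x0 mulr0 eq_sym oner_eq0.
Qed.

Lemma expiN (x : R) : expi (- x) = (expi x)^-1.
Proof. by apply: (mulIf (expi_neq0 x)); rewrite expiNK mulVf ?expi_neq0. Qed.

Lemma zeta_neq0 : zeta != 0.
Proof. exact: expi_neq0. Qed.

Lemma expiN_zeta n (x : R) : x = - (n%:R * (pi / 36)) -> expi x = zeta ^- n.
Proof. by move->; rewrite expiN expiMn. Qed.

Lemma conj_zeta : zeta^* = zeta^-1.
Proof. by rewrite conj_expi expiN. Qed.

Lemma i_zeta : 'i%C = zeta ^+ 18.
Proof.
rewrite -(@expi_zeta _ (pi / 2)); last by field.
by rewrite /expi cos_pihalf sin_pihalf.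
Qed.

(** Both sides are 2 cos(pi/4): this number is nonnegative, and its square is
zeta^-18 (zeta^36 + 2 zeta^18 + 1) = 2. *)
Lemma sqrt2_zeta : (Num.sqrt 2 : R)%:C%C = zeta ^+ 9 + zeta ^- 9.
Proof.
have z0 := zeta_neq0.
have cE : (2 * cos (pi / 4) : R)%:C%C = zeta ^+ 9 + zeta ^- 9.
  rewrite -(@expi_zeta _ (pi / 4)); last by field.
  rewrite -expiN -conj_expi /expi.
  by apply/eqP; rewrite eq_complex /= subrr eqxx andbT; apply/eqP; ring.
rewrite -cE; congr (_%:C%C).
have c0 : 0 <= 2 * cos (pi / 4) :> R.
  rewrite mulr_ge0 // cos_ge0_pihalf //.
  by have := pi_gt0 R; move=> ?; apply/andP; split; lra.
rewrite -[RHS]ger0_norm // -sqrtr_sqr; congr Num.sqrt.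
apply: (@complexI R); rewrite rmorphXn /= cE.
have -> : (zeta ^+ 9 + zeta ^- 9) ^+ 2 =
    zeta ^- 18 * (zeta ^+ 36 + 2 * zeta ^+ 18 + 1) by field.
rewrite zeta36 rmorph_nat.
by rewrite -addrA addrCA addNr addr0 mulrCA mulVf ?expf_neq0 // mulr1.
Qed.

Lemma Akauf_zeta : Akauf R = zeta ^+ 15.
Proof.
rewrite /Akauf i_zeta (@expiN_zeta 3); last by field.
by have := zeta_neq0 => ?; field.
Qed.

Lemma Akauf8 : Akauf R ^+ 8 = Akauf R ^+ 4 - 1.
Proof. rewrite Akauf_zeta; ring: zeta24. Qed.

Lemma tpar_Akauf : tpar R = (Akauf R ^+ 7 + Akauf R) / 2.
Proof.
have z0 := zeta_neq0.
rewrite /tpar Akauf_zeta rmorphM /= sqrt2_zeta (@expi_zeta 24); last by field.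
rewrite fmorphV rmorph_nat.
transitivity ((zeta ^+ 33 + zeta ^+ 15) / 2); first by field.
congr (_ / 2); ring: zeta24.
Qed.

End RootsOfUnity.

(** * Subgroups of the units of a ring *)

Section Subgroups.
Variable T : unitRingType.
Implicit Types (S K N H : set T) (x y a b : T).

Lemma generated_subgroup S : is_subgroup (generated S).
Proof.
split=> [A [[]//]|x y Sx Sy A SA|x Sx A SA].
  by have [[_ mA _] _] := SA; apply: mA; [apply: Sx | apply: Sy].
by have [[_ _ vA] _] := SA; apply: vA; apply: Sx.
Qed.

Lemma generated_incl S : S `<=` generated S.
Proof. exact: sub_gen_smallest. Qed.

Lemma generated_min S K : is_subgroup K -> S `<=` K -> generated S `<=` K.
Proof. exact: smallest_sub. Qed.

Lemma subgroupX K x n : is_subgroup K -> K x -> K (x ^+ n).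
Proof. by case=> K1 KM _ Kx; elim: n => // n IHn; rewrite exprS; apply: KM. Qed.

Lemma unit_expr1 x n : (0 < n)%N -> x ^+ n = 1 -> x \is a GRing.unit.
Proof. by move=> n0 xn; rewrite -(unitrX_pos _ n0) xn unitr1. Qed.

(** Every m that 18 does not divide has a multiple congruent to 6 or to 9 modulo
18, the two maximal proper divisors of 18. *)
Lemma has_order18 x : x ^+ 18 = 1 -> x ^+ 6 <> 1 -> x ^+ 9 <> 1 -> has_order x 18.
Proof.
move=> x18 x6 x9; split=> // m m18 xm.
have /allP/(_ m) : all (fun m => has (fun k => (k * m %% 18 == 6) ||
    (k * m %% 18 == 9))%N (iota 0 18)) (iota 1 17) by [].
rewrite mem_iota addSn => /(_ m18)/hasP[k _].
have : x ^+ (k * m %% 18) = 1 by rewrite (expr_mod _ x18) mulnC exprM xm expr1n.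
by move=> + /orP[] /eqP km; rewrite km.
Qed.

End Subgroups.

(** It is easier to parametrize a matrix group by an abstract group than to read
the parameters off a matrix; the inverse bijection comes from the axiom of
choice, and [u0] is its value outside [A]. *)
Lemma group_isomorphic_inv (T U : Type) (opT : T -> T -> T) (opU : U -> U -> U)
    (A : set T) (B : set U) (g : U -> T) (u0 : U) :
  is_group_isom opU opT B A g -> (forall x y, B x -> B y -> B (opU x y)) ->
  group_isomorphic opT opU A B.
Proof.
move=> [[gBA ginj gsurj] gM] opB.
have /boolp.choice[f fP] : forall x, exists u, A x -> B u /\ g u = x.
  move=> x; have [Ax|nAx] := pselect (A x); last by exists u0.
  by have [u Bu <-] := gsurj x Ax; exists u.
have fB x : A x -> B (f x) by move=> /fP[].
have gf x : A x -> g (f x) = x by move=> /fP[].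
have fg u v : B u -> B v -> g u = g v -> u = v.
  by move=> Bu Bv; apply: ginj; rewrite inE.
exists f; split; first split.
- by [].
- by move=> x y; rewrite !inE => Ax Ay fxy; rewrite -(gf x) // -(gf y) // fxy.
- move=> u Bu; have Agu := gBA _ Bu; exists (g u) => //.
  by apply: fg => //; [apply: fB | apply: gf].
move=> x y Ax Ay; have Axy : A (opT x y).
  by rewrite -(gf x) // -(gf y) // -gM; [apply/gBA/opB; apply: fB | apply: fB..].
by apply: fg; rewrite ?gM ?gf //; [apply: fB | apply: opB; apply: fB | apply: fB..].
Qed.

Section CommutingPair.
Variables (T : unitRingType) (a b : T) (p q : nat).
Hypotheses (p_gt1 : (1 < p)%N) (q_gt1 : (1 < q)%N).
Hypotheses (comm_ab : a * b = b * a) (a_p : a ^+ p = 1) (b_q : b ^+ q = 1).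

Lemma commuting_pairM i j k l :
  (a ^+ i * b ^+ j) * (a ^+ k * b ^+ l) = a ^+ (i + k) * b ^+ (j + l).
Proof.
have ab : GRing.comm (a ^+ k) (b ^+ j) by apply/commrX/commr_sym/commrX/commr_sym.
by rewrite mulrA -(mulrA (a ^+ i)) -ab !exprD !mulrA.
Qed.

Lemma generated_pair :
  generated [set a; b] = [set x | exists i j, x = a ^+ i * b ^+ j].
Proof.
apply/seteqP; split.
  apply: generated_min; last first.
    by move=> x [->|->]; [exists 1%N, 0%N | exists 0%N, 1%N]; rewrite expr1 ?mulr1 ?mul1r.
  split=> [|x y [i [j ->]] [k [l ->]]|x [i [j ->]]].
  - by exists 0%N, 0%N; rewrite mulr1.
  - by exists (i + k)%N, (j + l)%N; rewrite commuting_pairM.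
  exists (p.-1 * i)%N, (q.-1 * j)%N.
  have e : a ^+ i * b ^+ j * (a ^+ (p.-1 * i) * b ^+ (q.-1 * j)) = 1.
    rewrite commuting_pairM -!mulSn !prednK ?(ltnW p_gt1) ?(ltnW q_gt1) //.
    by rewrite !exprM a_p b_q !expr1n mulr1.
  have ua := unit_expr1 (ltnW p_gt1) a_p; have ub := unit_expr1 (ltnW q_gt1) b_q.
  have u : a ^+ i * b ^+ j \is a GRing.unit by rewrite unitrMr ?unitrX.
  by apply: (mulrI u); rewrite divrr.
move=> x [i [j ->]]; have sG := generated_subgroup [set a; b].
have Ga : generated [set a; b] a by apply: generated_incl; left.
have Gb : generated [set a; b] b by apply: generated_incl; right.
by have [_ GM _] := sG; exact: GM (subgroupX i sG Ga) (subgroupX j sG Gb).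
Qed.

Hypothesis indep : forall i j, a ^+ i * b ^+ j = 1 -> (p %| i)%N && (q %| j)%N.

(** Two commuting elements of orders p and q that satisfy no joint relation
generate Z_p x Z_q. *)
Lemma generated_pair_isom :
  group_isomorphic *%R *%g (generated [set a; b]) [set: 'Z_p * 'Z_q].
Proof.
pose g (u : 'Z_p * 'Z_q) := a ^+ u.1 * b ^+ u.2.
have lt1 (u : 'Z_p) : (u < p)%N by rewrite -{2}(Zp_cast p_gt1).
have lt2 (u : 'Z_q) : (u < q)%N by rewrite -{2}(Zp_cast q_gt1).
have ea k : a ^+ (k %% (Zp_trunc p).+2) = a ^+ k by rewrite Zp_cast ?expr_mod.
have eb k : b ^+ (k %% (Zp_trunc q).+2) = b ^+ k by rewrite Zp_cast ?expr_mod.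
apply: (@group_isomorphic_inv _ _ _ _ _ _ g 1%g) => //; split; first split.
- by move=> u _; rewrite generated_pair; exists u.1, u.2.
- move=> u v _ _ guv.
  have : a ^+ (u.1 + (p - v.1)) * b ^+ (u.2 + (q - v.2)) = 1.
    rewrite -commuting_pairM -[X in X * _]/(g u) guv commuting_pairM !subnKC 1?ltnW //.
    by rewrite a_p b_q mulr1.
  move=> /indep/andP[d1 d2].
  have eq_mod n i k : (i < n)%N -> (k < n)%N -> (n %| i + (n - k))%N -> i = k.
    move=> ltin ltkn /dvdnP[[|[|c]] e]; nia.
  by case: u v d1 d2 {guv} => [u1 u2] [v1 v2] /= d1 d2; congr (_, _);
    apply/val_inj;
    [exact: eq_mod (lt1 _) (lt1 _) d1 | exact: eq_mod (lt2 _) (lt2 _) d2].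
- move=> x; rewrite generated_pair => -[i [j ->]].
  by exists (inZp i, inZp j) => //; rewrite /g /= ea eb.
by move=> u v _ _; rewrite /g commuting_pairM /= ea eb.
Qed.

End CommutingPair.

Section Semidirect.
Variables (T : unitRingType) (S N H : set T).
Local Notation G := (generated S).
Hypothesis unitG : forall x, G x -> x \is a GRing.unit.
Hypotheses (nNG : is_normal_subgroup G N) (sH : is_subgroup H) (HG : H `<=` G).
Hypothesis NH1 : forall x, N x -> H x -> x = 1.
Hypothesis SNH : forall x, S x -> exists n h, [/\ N n, H h & x = n * h].

Lemma normal_conjV h n : H h -> N n -> N (h^-1 * n * h).
Proof.
have [_ _ nN] := nNG; have [_ _ HV] := sH => Hh Nn.
by rewrite -{2}[h]invrK; exact: nN (HG (HV _ Hh)) Nn.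
Qed.

(** The products n h form a subgroup because N is normal, and this subgroup
contains the generators. *)
Lemma semidirect_generated x : G x -> exists n h, [/\ N n, H h & x = n * h].
Proof.
have [[N1 NM NV] NG nN] := nNG; have [H1 HM HV] := sH.
move: x; apply: (generated_min (K := [set x | exists n h, [/\ N n, H h & x = n * h]])) => //.
split=> [|x y [n [h [Nn Hh ->]]] [n' [h' [Nn' Hh' ->]]]|x [n [h [Nn Hh ->]]]].
- by exists 1, 1; rewrite mulr1.
- have uh := unitG (HG Hh).
  exists (n * (h * n' * h^-1)), (h * h'); split.
  + by apply: NM => //; apply: nN => //; apply: HG.
  + exact: HM.
  + by rewrite !mulrA mulrVK.
- have uh := unitG (HG Hh); have un := unitG (NG _ Nn).
  exists (h^-1 * n^-1 * h), h^-1; split.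
  + by apply: normal_conjV => //; apply: NV.
  + exact: HV.
  + by rewrite mulrK // invrM.
Qed.

Lemma semidirect_product_generated :
  is_semidirect_product G N H (fun h n => h * n * h^-1).
Proof.
have [[N1 NM NV] NG nN] := nNG; have [H1 HM HV] := sH.
have uH h : H h -> h \is a GRing.unit by move=> /HG/unitG.
have uN n : N n -> n \is a GRing.unit by move=> /NG/unitG.
split=> [h Hh|h k x Hh Hk _|]; last first; first split; first split.
- move=> [n h] [/= Nn Hh]; have [_ GM _] := generated_subgroup S.
  by apply: GM; [apply: NG | apply: HG].
- move=> [n h] [n' h']; rewrite !inE => -[/= Nn Hh] [/= Nn' Hh'] nh.
  have hn : n'^-1 * n = h' * h^-1.
    by apply: (mulrI (uN _ Nn')); apply: (mulIr (uH _ Hh));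
      rewrite !mulrA divrr ?uN // mul1r nh mulrVK ?uH.
  have e1 : n'^-1 * n = 1.
    by apply: NH1; [apply: NM; [apply: NV|] | rewrite hn; apply: HM; [|apply: HV]].
  congr (_, _).
    by rewrite -[n]mul1r -(divrr (uN _ Nn')) -mulrA e1 mulr1.
  by rewrite -[h']mulr1 -(mulVr (uH _ Hh)) mulrA -hn e1 mul1r.
- by move=> x /semidirect_generated[n [h [Nn Hh ->]]]; exists (n, h).
- move=> [n h] [n' h'] [/= Nn Hh] [/= Nn' Hh']; rewrite /semidirect_mul /=.
  by rewrite !mulrA mulrVK ?uH.
- by rewrite invrM ?uH // !mulrA.
split; first split.
- by move=> n Nn; apply: nN => //; apply: HG.
- move=> n n' _ _ /(mulIr (_ : h^-1 \is a GRing.unit)) e.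
  by apply: (mulrI (uH _ Hh)); apply: e; rewrite unitrV uH.
- move=> n Nn; exists (h^-1 * n * h); first exact: normal_conjV.
  by rewrite !mulrA divrr ?uH // mul1r mulrK ?uH.
- by move=> n n' _ _; rewrite !mulrA mulrVK ?uH.
Qed.

End Semidirect.

(** * The generators in terms of a 9th root of unity *)

Section Matrices.
Variable R : realType.
Local Notation C := R[i].

Lemma mx3M (a b c d e f g h k a' b' c' d' e' f' g' h' k' : C) :
  mx3 [:: [:: a; b; c]; [:: d; e; f]; [:: g; h; k]] *
  mx3 [:: [:: a'; b'; c']; [:: d'; e'; f']; [:: g'; h'; k']] =
  mx3 [:: [:: a * a' + b * d' + c * g'; a * b' + b * e' + c * h'; a * c' + b * f' + c * k'];
          [:: d * a' + e * d' + f * g'; d * b' + e * e' + f * h'; d * c' + e * f' + f * k'];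
          [:: g * a' + h * d' + k * g'; g * b' + h * e' + k * h'; g * c' + h * f' + k * k']].
Proof.
apply/matrixP => i j; rewrite !mxE !big_ord_recl big_ord0 !mxE addr0 addrA.
by case: i j => [[|[|[|i]]] lti] [[|[|[|j]]] ltj].
Qed.

Lemma mx3Z (x a b c d e f g h k : C) :
  x *: mx3 [:: [:: a; b; c]; [:: d; e; f]; [:: g; h; k]] =
  mx3 [:: [:: x * a; x * b; x * c]; [:: x * d; x * e; x * f]; [:: x * g; x * h; x * k]].
Proof.
by apply/matrixP => i j; rewrite !mxE; case: i j => [[|[|[|i]]] lti] [[|[|[|j]]] ltj].
Qed.

Lemma mx3_adj (a b c d e f g h k : C) :
  map_mx Num.conj (mx3 [:: [:: a; b; c]; [:: d; e; f]; [:: g; h; k]])^T =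
  mx3 [:: [:: a^*; d^*; g^*]; [:: b^*; e^*; h^*]; [:: c^*; f^*; k^*]].
Proof.
by apply/matrixP => i j; rewrite !mxE; case: i j => [[|[|[|i]]] lti] [[|[|[|j]]] ltj].
Qed.

Lemma mx3_1 : 1 = mx3 [:: [:: 1; 0; 0]; [:: 0; 1; 0]; [:: 0; 0; 1]] :> 'M[C]_3.
Proof.
by apply/matrixP => i j; rewrite !mxE; case: i j => [[|[|[|i]]] lti] [[|[|[|j]]] ltj].
Qed.

Lemma diag3E (a b c : C) : diag3 a b c = diag_mx (\row_j nth 0 [:: a; b; c] j).
Proof.
by apply/matrixP => i j; rewrite !mxE; case: i j => [[|[|[|i]]] lti] [[|[|[|j]]] ltj].
Qed.

Lemma det_diag3 (a b c : C) : \det (diag3 a b c) = a * b * c.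
Proof. by rewrite diag3E det_diag !big_ord_recl big_ord0 !mxE /= mulr1 mulrA. Qed.

Lemma diag3M (a b c a' b' c' : C) :
  diag3 a b c * diag3 a' b' c' = diag3 (a * a') (b * b') (c * c').
Proof. by rewrite /diag3 mx3M; congr mx3; repeat congr cons; ring. Qed.

Lemma diag3X (a b c : C) n : diag3 a b c ^+ n = diag3 (a ^+ n) (b ^+ n) (c ^+ n).
Proof.
by elim: n => [|n IHn]; [rewrite expr0 mx3_1 | rewrite !exprS IHn diag3M].
Qed.

Lemma diag3_inj (a b c a' b' c' : C) :
  diag3 a b c = diag3 a' b' c' -> [/\ a = a', b = b' & c = c'].
Proof.
move=> /matrixP e; have := (e 0 0, e 1 1, e ord_max ord_max).
by rewrite !mxE /= => -[[]].
Qed.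

Definition omega : C := zeta R ^+ 8.

Lemma omega9 : omega ^+ 9 = 1.
Proof. by rewrite /omega -exprM -[(8 * 9)%N]/(36 * 2)%N exprM zeta36 sqrrN expr1n. Qed.

Lemma omega3_neq1 : omega ^+ 3 != 1.
Proof.
rewrite /omega -exprM (zeta24 R); apply/eqP => z12.
(* If omega^3 = zeta^24 = zeta^12 - 1 were 1, then zeta^36 would be 8, not -1. *)
have : zeta R ^+ 12 = 2 by rewrite -[LHS](subrK 1) z12.
move=> z12'; have : zeta R ^+ 36 = 8.
  by rewrite -[36%N]/(12 * 3)%N exprM z12' -natrX.
rewrite zeta36 => /eqP; rewrite eq_sym -subr_eq0 opprK.
by rewrite natr1 pnatr_eq0.
Qed.

(** The order of [omega] divides 9, and it is neither 1 nor 3 as omega^3 is not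
1. *)
Lemma omega_prim : 9.-primitive_root omega.
Proof.
have [m mprim] := @prim_order_exists _ 9 omega isT omega9.
rewrite dvdn_divisors // => /= m9; have: m \in [:: 1; 3; 9]%N by [].
rewrite !inE => /or3P[] /eqP mE; move: mprim; rewrite mE // => /prim_expr_order e;
  case/eqP: omega3_neq1 => //.
by move: e; rewrite expr1 => ->; rewrite expr1n.
Qed.

Definition half_sqrt2 : C := (Num.sqrt 2 / 2)%:C%C.

Lemma half_sqrt2_sq : half_sqrt2 ^+ 2 = 1 / 2.
Proof.
rewrite /half_sqrt2 -rmorphXn /= expr_div_n sqr_sqrtr //.
rewrite [X in X%:C%C](_ : _ = 1 / 2); last by field.
by rewrite rmorphM /= fmorphV rmorph_nat rmorph1.
Qed.

Lemma conj_half_sqrt2 : half_sqrt2^* = half_sqrt2.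
Proof. exact: conjc_real. Qed.

Lemma conj_omega : omega^* = omega ^+ 8.
Proof.
have o0 : omega != 0 by rewrite expf_neq0 ?zeta_neq0.
apply: (mulIf o0); rewrite -exprSr omega9 /omega rmorphXn /= conj_zeta exprVn.
by rewrite mulVf.
Qed.

Lemma G1_omega : G1 R = diag3 (- omega ^+ 8) (- omega ^+ 2) (omega ^+ 8).
Proof.
have z9 : expi (pi / 9 : R) = zeta R ^+ 4 by apply: expi_zeta; field.
have z24 : expi (2 * pi / 3 : R) = zeta R ^+ 24 by apply: expi_zeta; field.
have tE : tpar R = half_sqrt2 * zeta R ^+ 24 by rewrite -z24.
have z0 : zeta R ^+ 48 != 0 by rewrite expf_neq0 ?zeta_neq0.
have t2 : 2 * tpar R ^+ 2 = zeta R ^+ 48.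
  by rewrite tE exprMn half_sqrt2_sq -exprM; field.
have t2' : 2 * (tpar R)^* ^+ 2 = zeta R ^- 48.
  have -> : 2 * (tpar R)^* ^+ 2 = (2 * tpar R ^+ 2)^*.
    by rewrite [RHS]rmorphM [in RHS]rmorphXn [in RHS]rmorph_nat.
  by rewrite t2 rmorphXn /= conj_zeta exprVn.
have e1 : zeta R ^+ 4 * zeta R ^+ 48 = - omega ^+ 2 by rewrite /omega; ring: (zeta24 R).
have e2 : zeta R ^+ 4 * zeta R ^- 48 = - omega ^+ 8.
  by apply: (mulIf z0); rewrite (mulfVK z0) /omega; ring: (zeta24 R).
have q1 : expi (pi / 9 : R) * (2 * (tpar R)^* ^+ 2) = - omega ^+ 8.
  by rewrite z9 t2' e2.
have q2 : expi (pi / 9 : R) * (2 * tpar R ^+ 2) = - omega ^+ 2.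
  by rewrite z9 t2 e1.
rewrite /G1 /diag3 mx3Z mulrN !mulr0 -/(diag3 _ _ _) -/(diag3 _ _ _).
congr diag3; [exact: q1 | exact: q2 | by rewrite q1 opprK].
Qed.

Lemma G2_omega : G2 R = mx3
  [:: [:: - omega ^+ 2 / 2; - (half_sqrt2 * omega ^+ 8); omega ^+ 2 / 2];
      [:: - (half_sqrt2 * omega ^+ 8); 0; - (half_sqrt2 * omega ^+ 8)];
      [:: omega ^+ 2 / 2; - (half_sqrt2 * omega ^+ 8); - omega ^+ 2 / 2]].
Proof.
have z9 : expi (pi / 9 : R) = zeta R ^+ 4 by apply: expi_zeta; field.
have z24 : expi (2 * pi / 3 : R) = zeta R ^+ 24 by apply: expi_zeta; field.
have tE : zeta R ^+ 4 * tpar R = - (half_sqrt2 * omega ^+ 8).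
  rewrite /tpar z24 -/half_sqrt2 /omega; ring: (zeta24 R).
have tE2 : zeta R ^+ 4 * tpar R ^+ 2 = - omega ^+ 2 / 2.
  rewrite /tpar z24 -/half_sqrt2 /omega exprMn half_sqrt2_sq; transitivity (zeta R ^+ 52 / 2).
    by field.
  congr (_ / 2); ring: (zeta24 R).
rewrite /G2 mx3Z z9 mulrN tE tE2 mulr0.
by congr mx3; repeat congr cons; rewrite // mulNr opprK.
Qed.

End Matrices.

(** * Monomial coordinates *)

Section Monomial.
Variable R : realType.
Local Notation C := R[i].
Local Notation w := (omega R).
Local Notation q := (half_sqrt2 R).

(** An orthonormal basis in which all the generators are monomial: N is
commutative, and these are its common eigenvectors. The matrix is its own
inverse. *)
Definition basis_mx : 'M[C]_3 := mx3 [:: [:: q; 0; q]; [:: 0; 1; 0]; [:: q; 0; - q]].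
Definition wdiag (a b c : nat) : 'M[C]_3 := diag3 (w ^+ a) (w ^+ b) (w ^+ c).
(** Up to sign, [monoD] and [monoW] are the permutation matrices of (13) and (23).
They represent D and G_1 G_2 G_1 in the new coordinates, just as [mono1] and
[mono2] represent G_1 and G_2. *)
Definition monoD : 'M[C]_3 := mx3 [:: [:: 0; 0; -1]; [:: 0; -1; 0]; [:: -1; 0; 0]].
Definition monoW : 'M[C]_3 := mx3 [:: [:: -1; 0; 0]; [:: 0; 0; -1]; [:: 0; -1; 0]].
Definition mono1 : 'M[C]_3 := mx3
  [:: [:: 0; 0; - w ^+ 8]; [:: 0; - w ^+ 2; 0]; [:: - w ^+ 8; 0; 0]].
Definition mono2 : 'M[C]_3 := mx3
  [:: [:: 0; - w ^+ 8; 0]; [:: - w ^+ 8; 0; 0]; [:: 0; 0; - w ^+ 2]].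

Lemma half_sqrt2_double : q * q + q * q = 1.
Proof. by rewrite -expr2 half_sqrt2_sq; field. Qed.

Ltac entries :=
  rewrite /wdiag /diag3 ?expr2 ?mx3M ?(mx3_1 R);
  move: (omega R) (omega9 R) (half_sqrt2 R) half_sqrt2_double => o o9 r rr;
  congr mx3; repeat congr cons.

Ltac wring := entries; match goal with H : _ ^+ 9 = 1 |- _ => ring: H end.

Lemma basis_mxK : basis_mx * basis_mx = 1.
Proof.
rewrite /basis_mx; entries; try by ring.
all: by rewrite -[RHS]rr; ring.
Qed.

Definition conjB (A : 'M[C]_3) : 'M[C]_3 := basis_mx * A * basis_mx.

Lemma conjBK : involutive conjB.
Proof. by move=> A; rewrite /conjB !mulrA basis_mxK mul1r -mulrA basis_mxK mulr1. Qed.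

Lemma conjBM A B : conjB A * conjB B = conjB (A * B).
Proof. by rewrite /conjB !mulrA -(mulrA _ basis_mx basis_mx) basis_mxK mulr1. Qed.

Lemma conjB1 : conjB 1 = 1.
Proof. by rewrite /conjB mulr1 basis_mxK. Qed.

Lemma conjB_eq A B : A * basis_mx = basis_mx * B -> A = conjB B.
Proof. by rewrite /conjB => <-; rewrite -mulrA basis_mxK mulr1. Qed.

Lemma conjBX A n : conjB A ^+ n = conjB (A ^+ n).
Proof. by elim: n => [|n IHn]; rewrite ?expr0 ?conjB1 // !exprS IHn conjBM. Qed.

Lemma conjB_unit A : A \is a GRing.unit -> conjB A \is a GRing.unit.
Proof.
have uP : basis_mx \is a GRing.unit by apply: (@unit_expr1 _ _ 2); rewrite // expr2 basis_mxK.
by move=> uA; rewrite /conjB !unitrMl.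
Qed.

#[global] Opaque conjB.

Lemma G1_conjB : G1 R = conjB mono1.
Proof.
apply: conjB_eq; rewrite G1_omega /basis_mx /mono1.
by entries; ring.
Qed.

Lemma G2_conjB : G2 R = conjB mono2.
Proof.
apply: conjB_eq; rewrite G2_omega /basis_mx /mono2.
entries; try by field.
by rewrite -[RHS]mul1r -[X in _ = X * _]rr; ring.
Qed.

Lemma matD_conjB : matD R = conjB monoD.
Proof.
apply: conjB_eq; rewrite /matD /basis_mx /monoD.
by entries; ring.
Qed.

Lemma G121_conjB : G1 R * G2 R * G1 R = conjB monoW.
Proof.
by rewrite G1_conjB G2_conjB !conjBM; congr conjB; rewrite /mono1 /mono2 /monoW; wring.
Qed.

Lemma braid_relation : G1 R * G2 R * G1 R = G2 R * G1 R * G2 R.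
Proof. by rewrite G1_conjB G2_conjB !conjBM; congr conjB; rewrite /mono1 /mono2; wring. Qed.

Lemma mono1_sq : mono1 ^+ 2 = wdiag 7 4 7.
Proof. rewrite /mono1; wring. Qed.

Lemma mono2_sq : mono2 ^+ 2 = wdiag 7 7 4.
Proof. rewrite /mono2; wring. Qed.

Lemma wdiagM a b c a' b' c' :
  wdiag a b c * wdiag a' b' c' = wdiag (a + a') (b + b') (c + c').
Proof. by rewrite /wdiag diag3M -!exprD. Qed.

Lemma wdiagX a b c n : wdiag a b c ^+ n = wdiag (a * n) (b * n) (c * n).
Proof. by rewrite /wdiag diag3X -!exprM. Qed.

(** The exponents of a diagonal matrix are determined modulo 9; equality of
diagonal matrices is thereby decided by arithmetic. *)
Lemma eq_wdiag a b c a' b' c' :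
  (wdiag a b c == wdiag a' b' c') =
  [&& a == a' %[mod 9], b == b' %[mod 9] & c == c' %[mod 9]].
Proof.
rewrite -!(eq_prim_root_expr (omega_prim R)).
by apply/eqP/and3P => [/diag3_inj[-> -> ->] | [/eqP ea /eqP eb /eqP ec]];
  rewrite // /wdiag ea eb ec.
Qed.

Lemma wdiag0 : wdiag 0 0 0 = 1.
Proof. by rewrite /wdiag !expr0 mx3_1. Qed.

Lemma squares_commute : G1 R ^+ 2 * G2 R ^+ 2 = G2 R ^+ 2 * G1 R ^+ 2.
Proof. by rewrite G1_conjB G2_conjB !conjBX !conjBM mono1_sq mono2_sq !wdiagM. Qed.

Lemma mono1E : mono1 = wdiag 8 2 8 * monoD.
Proof. rewrite /mono1 /monoD; wring. Qed.

Lemma mono2E : mono2 = wdiag 8 8 2 * (monoD * monoW * monoD).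
Proof. rewrite /mono2 /monoD /monoW; wring. Qed.

End Monomial.

(** * Spectrum, orders and determinants *)

Section GroupG.
Variable R : realType.
Local Notation C := R[i].
Local Notation w := (omega R).
Local Notation G1 := (G1 R).
Local Notation G2 := (G2 R).

Lemma wdiag1 a b c : (9 %| a)%N -> (9 %| b)%N -> (9 %| c)%N -> wdiag R a b c = 1.
Proof.
by move=> /eqP a0 /eqP b0 /eqP c0; apply/eqP; rewrite -(wdiag0 R) eq_wdiag a0 b0 c0.
Qed.

Lemma G1_expr18 : G1 ^+ 18 = 1.
Proof.
by rewrite G1_conjB conjBX -[18%N]/(2 * 9)%N exprM mono1_sq wdiagX wdiag1 // conjB1.
Qed.

Lemma G2_expr18 : G2 ^+ 18 = 1.
Proof.
by rewrite G2_conjB conjBX -[18%N]/(2 * 9)%N exprM mono2_sq wdiagX wdiag1 // conjB1.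
Qed.

Lemma unit_G1 : G1 \is a GRing.unit. Proof. exact: unit_expr1 G1_expr18. Qed.
Lemma unit_G2 : G2 \is a GRing.unit. Proof. exact: unit_expr1 G2_expr18. Qed.

Lemma unit_G12 : G1 * G2 \is a GRing.unit.
Proof. by rewrite unitrMl ?unit_G1 ?unit_G2. Qed.

(** The braid relation says that G_1 G_2 conjugates G_1 into G_2. *)
Lemma G2_conj : G1 * G2 * G1 = G2 * (G1 * G2).
Proof. by rewrite braid_relation mulrA. Qed.

Lemma G2_conjX n : G1 * G2 * G1 ^+ n = G2 ^+ n * (G1 * G2).
Proof.
elim: n => [|n IHn]; first by rewrite !expr0 mulr1 mul1r.
by rewrite exprSr mulrA IHn exprSr -!mulrA [G1 * (G2 * G1)]mulrA G2_conj.
Qed.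

Lemma order_G1 : has_order G1 18.
Proof.
apply: (has_order18 G1_expr18).
  (* The square of G_1 is diag(w^7, w^4, w^7) in the monomial coordinates, and
     its cube is not 1. *)
  rewrite G1_conjB conjBX -[6%N]/(2 * 3)%N exprM mono1_sq wdiagX => /(congr1 (@conjB R)).
  by rewrite conjBK conjB1 -(wdiag0 R) => /eqP; rewrite eq_wdiag.
(* The 9th power of the first entry -w^8 of G_1 is -1. *)
rewrite G1_omega diag3X -[in RHS](wdiag0 R) /wdiag expr0 => /diag3_inj[/eqP + _ _].
rewrite exprNn -exprM mulnC exprM omega9 expr1n mulr1 -signr_odd /= expr1.
by rewrite eq_sym -subr_eq0 opprK -[1 + 1]/(2%:R) pnatr_eq0.
Qed.

Lemma order_G2 : has_order G2 18.
Proof.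
have [_ _ o1] := order_G1; split; [by [] | exact: G2_expr18 | move=> m m18 G2m].
apply: (o1 m m18); apply: (mulrI unit_G12).
by rewrite G2_conjX G2m mul1r mulr1.
Qed.

Lemma G1_diag :
  G1 = diag3 (expi (7 * pi / 9)) (- expi (4 * pi / 9)) (expi (- 2 * pi / 9)).
Proof.
rewrite G1_omega.
have -> : expi (7 * pi / 9 : R) = - w ^+ 8.
  by rewrite (@expi_zeta _ 28) /omega; [ring: (zeta24 R) | field].
have -> : expi (4 * pi / 9 : R) = w ^+ 2.
  by rewrite (@expi_zeta _ 16) /omega; [ring | field].
congr diag3; have wV : w ^+ 8 * w = 1 by rewrite -exprSr omega9.
rewrite (@expiN_zeta _ 8) /omega; last by field.
by rewrite -[LHS]mulr1 -[X in _ * X](mulfV (expf_neq0 8 (zeta_neq0 R))) mulrA wV mul1r.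
Qed.

Lemma eigenvalue_conj (A B U : 'M[C]_3) : U \is a GRing.unit ->
  U * A = B * U -> eigenvalue A =1 eigenvalue B.
Proof.
have half (A' B' U' : 'M[C]_3) x : U' \is a GRing.unit ->
    U' * A' = B' * U' -> eigenvalue B' x -> eigenvalue A' x.
  move=> uU UA /eigenvalueP[v vB v0]; apply/eigenvalueP; exists (v *m U').
    by rewrite -mulmxA -[_ *m A']/(U' * A') UA -[_ * _]/(B' *m U') mulmxA vB scalemxAl.
  by apply: contra v0 => /eqP vU; rewrite -(mulmxK uU v) vU mul0mx.
move=> uU UA x; apply/idP/idP; last exact: half uU UA.
apply: (half _ _ U^-1); first by rewrite unitrV.
by apply: (mulrI uU); rewrite !mulrA divrr // mul1r UA mulrK.
Qed.

Lemma SU3_subgroup : is_subgroup (SU3 R).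
Proof.
split=> [|A B [uA dA] [uB dB]|A [uA dA]].
- split; last exact: det1.
  by apply/unitarymxP; rewrite trmx1 map_mx1 mulmx1.
- by split; [apply: mul_unitarymx | rewrite det_mulmx dA dB mulr1].
split; last by rewrite det_inv dA invr1.
have uA' : A \is a GRing.unit by apply: unitarymx_unit.
have -> : A^-1 = map_mx Num.conj A^T.
  by apply: (mulrI uA'); rewrite divrr //; apply/esym/unitarymxP.
by rewrite trmxC_unitary.
Qed.

Lemma conj_omegaX n : (w ^+ n)^* = w ^+ (8 * n).
Proof. by rewrite exprM -conj_omega [LHS]rmorphXn. Qed.

Lemma conj_omegaXN n : (- w ^+ n)^* = - w ^+ (8 * n).
Proof. by rewrite -conj_omegaX [LHS]rmorphN. Qed.

Lemma SU3_G1 : SU3 R G1.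
Proof.
split; last first.
  by rewrite G1_omega det_diag3; ring: (omega9 R).
apply/unitarymxP; rewrite G1_omega /diag3 mx3_adj -[_ *m _]/(_ * _) mx3M -[1%:M]/1 mx3_1.
rewrite !conj_omegaXN ?conj_omegaX !rmorph0.
move: (omega R) (omega9 R) => o o9.
by congr mx3; repeat congr cons; ring: o9.
Qed.

Lemma unitary_basis_mx : basis_mx R \is unitarymx.
Proof.
apply/unitarymxP; rewrite -[RHS](basis_mxK R) -[_ *m _]/(_ * _); congr (_ * _).
by rewrite /basis_mx mx3_adj rmorphN /= conj_half_sqrt2 rmorph0 rmorph1.
Qed.

Lemma SU3_G2 : SU3 R G2.
Proof.
split; last first.
  have := congr1 (@determinant _ _) G2_conj.
  rewrite [X in X = _]det_mulmx [X in _ = X]det_mulmx SU3_G1.2 mulr1 => /esym e.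
  have d0 : \det (G1 * G2) != 0 by rewrite -unitfE; apply: unit_G12.
  by apply: (mulIf d0); rewrite e mul1r.
rewrite G2_conjB; apply: mul_unitarymx unitary_basis_mx.
apply: mul_unitarymx unitary_basis_mx _.
apply/unitarymxP; rewrite /mono2 mx3_adj -[_ *m _]/(_ * _) mx3M -[1%:M]/1 mx3_1.
rewrite !conj_omegaXN ?conj_omegaX !rmorph0.
move: (omega R) (omega9 R) => o o9.
by congr mx3; repeat congr cons; ring: o9.
Qed.

Lemma groupG_SU3 : groupG R `<=` SU3 R.
Proof.
apply: generated_min; first exact: SU3_subgroup.
by move=> x [->|->]; [exact: SU3_G1 | exact: SU3_G2].
Qed.

Lemma unit_groupG x : groupG R x -> x \is a GRing.unit.
Proof. by move=> /groupG_SU3[/unitarymx_unit]. Qed.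

Lemma G2_similar : similar_in unitarymx G2
  (diag3 (expi (7 * pi / 9)) (- expi (4 * pi / 9)) (expi (- 2 * pi / 9))).
Proof.
rewrite -G1_diag; have [_ M V] := SU3_subgroup.
have [uU _] : SU3 R (G1 * G2)^-1 by apply/V/M; [exact: SU3_G1 | exact: SU3_G2].
exists (G1 * G2)^-1; first exact: uU.
apply/similarP; first exact: unitarymx_unit.
rewrite -![_ *m _]/(_ * _); apply: (mulrI unit_G12).
by rewrite (mulVKr unit_G12) mulrA G2_conj (mulrK unit_G12).
Qed.

End GroupG.

(** * The normal subgroup N *)

Section SubgroupN.
Variable R : realType.
Local Notation C := R[i].
Local Notation G1 := (G1 R).
Local Notation G2 := (G2 R).
Local Notation n1 := (conjB (wdiag R 4 7 7)).
Local Notation n2 := (conjB (wdiag R 3 6 0)).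

(** As [mono1] is a diagonal matrix times a transposition matrix, conjugation by it
permutes the entries of a diagonal matrix; similarly for [mono2]. *)
Lemma mono1_wdiag a b c : mono1 R * wdiag R a b c = wdiag R c b a * mono1 R.
Proof.
rewrite /mono1 /wdiag /diag3 !mx3M; move: (omega R) => o.
by congr mx3; repeat congr cons; ring.
Qed.

Lemma mono2_wdiag a b c : mono2 R * wdiag R a b c = wdiag R b a c * mono2 R.
Proof.
rewrite /mono2 /wdiag /diag3 !mx3M; move: (omega R) => o.
by congr mx3; repeat congr cons; ring.
Qed.

Lemma groupN_gen1 : G1 * G2 ^+ 2 * G1^-1 = n1.
Proof.
apply: (mulIr (unit_G1 R)); rewrite (mulrVK (unit_G1 R)).
by rewrite G1_conjB G2_conjB conjBX !conjBM mono2_sq mono1_wdiag.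
Qed.

Lemma groupN_gen2 : G1 * G2 ^- 2 * G1 = n2.
Proof.
have -> : G2 ^- 2 = conjB (wdiag R 2 2 5).
  have u2 : G2 ^+ 2 \is a GRing.unit by rewrite unitrX ?unit_G2.
  apply: (mulrI u2); rewrite (divrr u2) G2_conjB conjBX mono2_sq conjBM wdiagM wdiag1 //.
  by rewrite conjB1.
rewrite G1_conjB !conjBM mono1_wdiag -mulrA -[mono1 R * mono1 R]/(mono1 R ^+ 2).
rewrite mono1_sq wdiagM.
by congr conjB; apply/eqP; rewrite eq_wdiag.
Qed.

Lemma groupN_generated : groupN R = generated [set n1; n2].
Proof. by rewrite /groupN groupN_gen1 groupN_gen2. Qed.

Lemma groupN_pair i j :
  n1 ^+ i * n2 ^+ j = conjB (wdiag R (4 * i + 3 * j) (7 * i + 6 * j) (7 * i)).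
Proof. by rewrite !conjBX conjBM !wdiagX wdiagM addn0. Qed.

Lemma n1_9 : n1 ^+ 9 = 1. Proof. by rewrite conjBX wdiagX wdiag1 // conjB1. Qed.
Lemma n2_3 : n2 ^+ 3 = 1. Proof. by rewrite conjBX wdiagX wdiag1 // conjB1. Qed.
Lemma n12_comm : n1 * n2 = n2 * n1. Proof. by rewrite !conjBM !wdiagM. Qed.

Lemma groupN_isom : group_isomorphic *%R *%g (groupN R) [set: 'Z_9 * 'Z_3].
Proof.
rewrite groupN_generated.
apply: generated_pair_isom n12_comm n1_9 n2_3 _ => // i j.
rewrite groupN_pair => /(congr1 (@conjB R)); rewrite conjBK conjB1 -(wdiag0 R) => /eqP.
by rewrite eq_wdiag => /and3P[]; lia.
Qed.

(** The triples of exponents that occur in N. Unlike the description of N by its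
two generators, this condition is symmetric in a, b, c; normality and membership
of given diagonal matrices are immediate from it. *)
Definition torus (a b c : nat) : bool :=
  [&& a == b %[mod 3], b == c %[mod 3] & 9 %| a + b + c]%N.

Lemma groupNP x :
  groupN R x <-> exists a b c, torus a b c /\ x = conjB (wdiag R a b c).
Proof.
rewrite groupN_generated (generated_pair _ _ n12_comm n1_9 n2_3) //; split.
  move=> [i [j ->]]; rewrite groupN_pair.
  by do 3 eexists; split; last reflexivity; rewrite /torus; lia.
move=> [a [b [c [/and3P[ab bc abc] ->]]]].
(* The last entry forces 7 i = c, so that i = 4 c modulo 9; the middle entry then
   asks for 6 j = b - c modulo 9, where 3 divides b + 8 c. *)
exists (4 * c)%N, (2 * ((b + 8 * c) %/ 3))%N; rewrite groupN_pair.
by congr conjB; apply/eqP; rewrite eq_wdiag; lia.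
Qed.

Lemma groupN_wdiag a b c : torus a b c -> groupN R (conjB (wdiag R a b c)).
Proof. by move=> t; apply/groupNP; exists a, b, c. Qed.

Lemma groupN_sub : groupN R `<=` groupG R.
Proof.
have sG := generated_subgroup [set G1; G2]; have [_ M V] := sG.
have g1 : groupG R G1 by apply: generated_incl; left.
have g2 : groupG R G2 by apply: generated_incl; right.
apply: generated_min => // x [->|->].
  by apply: (M _ _ (M _ _ g1 (subgroupX 2 sG g2)) (V _ g1)).
by apply: (M _ _ (M _ _ g1 (V _ (subgroupX 2 sG g2))) g1).
Qed.

Lemma groupN_normal : is_normal_subgroup (groupG R) (groupN R).
Proof.
pose wd (t : nat * nat * nat) := wdiag R t.1.1 t.1.2 t.2.
pose tor (t : nat * nat * nat) := torus t.1.1 t.1.2 t.2.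
have sN : is_subgroup (groupN R) by apply: generated_subgroup.
split=> // [|x y]; first exact: groupN_sub.
(* The condition on the inverse of x is included to make the normalizer, which is
   to contain the generators, visibly a subgroup. *)
suff main : groupG R `<=` [set x | x \is a GRing.unit /\ forall y, groupN R y ->
    groupN R (x * y * x^-1) /\ groupN R (x^-1 * y * x)].
  by move=> /main[_ nx] /nx[].
apply: generated_min => [|{}x {y}].
  split=> [|x' y' [ux nx] [uy ny]|x' [ux nx]].
  - by split; [exact: unitr1 | move=> y' Ny; rewrite invr1 !mul1r !mulr1].
  - split=> [|z Nz]; first by rewrite unitrMl.
    have [_ xz] := nx _ Nz; have [yz _] := ny _ Nz.
    rewrite invrM // !mulrA; split.
      by have [+ _] := nx _ yz; rewrite !mulrA.
    by have [_ +] := ny _ xz; rewrite !mulrA.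
  - split=> [|z /nx[? ?]]; first by rewrite unitrV.
    by rewrite invrK.
have normN (g m : 'M[C]_3) (p : nat * nat * nat -> nat * nat * nat) :
    g \is a GRing.unit -> g = conjB m -> involutive p ->
    (forall t, m * wd t = wd (p t) * m) -> (forall t, tor t -> tor (p t)) ->
    forall y, groupN R y -> groupN R (g * y * g^-1) /\ groupN R (g^-1 * y * g).
  move=> ug gm pK mp torp y /groupNP[a [b [c [abc ->]]]].
  have Np : groupN R (conjB (wd (p (a, b, c)))).
    by apply: groupN_wdiag; exact: (torp (a, b, c) abc).
  have e1 : g * conjB (wd (a, b, c)) = conjB (wd (p (a, b, c))) * g.
    by rewrite gm !conjBM mp.
  have e2 : g * conjB (wd (p (a, b, c))) = conjB (wd (a, b, c)) * g.
    by rewrite gm !conjBM mp pK.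
  split; first by rewrite -[conjB _]/(conjB (wd (a, b, c))) e1 (mulrK ug).
  by rewrite -mulrA -[conjB _]/(conjB (wd (a, b, c))) -e2 (mulKr ug).
case=> ->.
  split; first exact: unit_G1.
  apply: (normN _ _ (fun t => (t.2, t.1.2, t.1.1)) (unit_G1 R) (G1_conjB R)).
  - by move=> [[]].
  - by move=> t; apply: mono1_wdiag.
  - by move=> [[a b] c]; rewrite /tor /torus /=; lia.
split; first exact: unit_G2.
apply: (normN _ _ (fun t => (t.1.2, t.1.1, t.2)) (unit_G2 R) (G2_conjB R)).
- by move=> [[]].
- by move=> t; apply: mono2_wdiag.
- by move=> [[a b] c]; rewrite /tor /torus /=; lia.
Qed.

End SubgroupN.

(** * The complement H and the semidirect product *)

(** These are the six words by which H is defined, with (13) for D and (23) for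
G_1 G_2 G_1. *)
Lemma S3_words (s : 'S_3) (t := tperm ord0 ord_max : 'S_3)
    (u := tperm 1 ord_max : 'S_3) :
  [\/ s = 1%g, s = t, s = u | [\/ s = (t * u * t)%g, s = (u * t)%g | s = (t * u)%g]].
Proof.
have cases3 (i : 'I_3) : [\/ i = ord0, i = 1 | i = ord_max].
  by case: i => [[|[|[|i]]] lti] //;
    [constructor 1 | constructor 2 | constructor 3]; apply/val_inj.
have ext (v : 'S_3) : s ord0 = v ord0 -> s 1 = v 1 -> s ord_max = v ord_max -> s = v.
  by move=> e0 e1 e2; apply/permP => i; case: (cases3 i) => ->.
have s01 : s ord0 <> s 1 by move/perm_inj.
have s02 : s ord0 <> s ord_max by move/perm_inj.
have s12 : s 1 <> s ord_max by move/perm_inj.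
case: (cases3 (s ord0)) => e0; case: (cases3 (s 1)) => e1;
  case: (cases3 (s ord_max)) => e2; try by [case: s01; rewrite e0 e1 |
    case: s02; rewrite e0 e2 | case: s12; rewrite e1 e2].
- by constructor 1; apply: ext; rewrite perm1.
- by constructor 3; apply: ext; rewrite ?(e0, e1, e2) permE.
- by constructor 4; constructor 1; apply: ext; rewrite ?(e0, e1, e2) !permM !permE.
- by constructor 4; constructor 3; apply: ext; rewrite ?(e0, e1, e2) !permM !permE.
- by constructor 4; constructor 2; apply: ext; rewrite ?(e0, e1, e2) !permM !permE.
- by constructor 2; apply: ext; rewrite ?(e0, e1, e2) permE.
Qed.

Section SubgroupH.
Variable R : realType.
Local Notation C := R[i].
Local Notation G1 := (G1 R).
Local Notation G2 := (G2 R).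
Local Notation D := (monoD R).
Local Notation W := (monoW R).

(** The sign makes these matrices have determinant 1. *)
Definition signed_perm (s : 'S_3) : 'M[C]_3 := (-1) ^+ s *: perm_mx s.

Lemma signed_permM s t : signed_perm (s * t)%g = signed_perm s * signed_perm t.
Proof.
rewrite /signed_perm odd_permM signr_addb perm_mxM -[RHS]/(_ *m _).
by rewrite -scalemxAl -scalemxAr scalerA.
Qed.

Lemma signed_perm1 : signed_perm 1%g = 1.
Proof. by rewrite /signed_perm odd_perm1 scale1r perm_mx1. Qed.

Lemma signed_perm_neq0 s i : signed_perm s i (s i) != 0.
Proof. by rewrite !mxE eqxx mulr1 signr_eq0. Qed.

Lemma signed_perm_inj : injective signed_perm.
Proof.
move=> s t st; apply/permP => i; have := signed_perm_neq0 s i.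
rewrite st !mxE mulf_eq0 signr_eq0 /=.
by case: (t i =P s i) => [-> //|_]; rewrite eqxx.
Qed.

Lemma signed_perm_monoD : signed_perm (tperm ord0 ord_max) = D.
Proof.
apply/matrixP => i j; rewrite !mxE odd_tperm permE /=.
by case: i j => [[|[|[|i]]] lti] [[|[|[|j]]] ltj] //=; rewrite ?mulr1 ?mulr0 ?expr1.
Qed.

Lemma signed_perm_monoW : signed_perm (tperm 1 ord_max) = W.
Proof.
apply/matrixP => i j; rewrite !mxE odd_tperm permE /=.
by case: i j => [[|[|[|i]]] lti] [[|[|[|j]]] ltj] //=; rewrite ?mulr1 ?mulr0 ?expr1.
Qed.

Definition S3_rep (s : 'S_3) : 'M[C]_3 := conjB (signed_perm s).

Lemma S3_repM s t : S3_rep (s * t)%g = S3_rep s * S3_rep t.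
Proof. by rewrite /S3_rep signed_permM conjBM. Qed.

Lemma S3_rep1 : S3_rep 1%g = 1.
Proof. by rewrite /S3_rep signed_perm1 conjB1. Qed.

Lemma S3_rep_inj : injective S3_rep.
Proof. by move=> s t /(inv_inj (@conjBK R))/signed_perm_inj. Qed.

Lemma matD_rep : matD R = S3_rep (tperm ord0 ord_max).
Proof. by rewrite /S3_rep signed_perm_monoD matD_conjB. Qed.

Lemma G121_rep : G1 * G2 * G1 = S3_rep (tperm 1 ord_max).
Proof. by rewrite /S3_rep signed_perm_monoW G121_conjB. Qed.

Lemma wdiag_rep_eq1 a b c s : conjB (wdiag R a b c) = S3_rep s -> s = 1%g.
Proof.
move=> /(inv_inj (@conjBK R)) e; apply/permP => i; rewrite perm1.
have := signed_perm_neq0 s i; rewrite -e /wdiag diag3E !mxE.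
by case: (i =P s i) => [ei _|_]; [rewrite -ei | rewrite mulr0n eqxx].
Qed.

#[local] Opaque S3_rep.

Lemma setH_range : setH R = range S3_rep.
Proof.
rewrite /setH matD_rep G121_rep.
set t := tperm ord0 ord_max; set u := tperm 1 ord_max.
apply/seteqP; split => x.
  move=> [[[[[->|->]|->]|->]|->]|->].
  - by exists 1%g; last exact: S3_rep1.
  - by exists t.
  - by exists u.
  - by exists (t * u * t)%g; last by rewrite !S3_repM.
  - by exists (u * t)%g; last by rewrite S3_repM.
  - by exists (t * u)%g; last by rewrite S3_repM.
move=> [s _ <-]; case: (S3_words s) => [->|->|->|[->|->|->]]; rewrite -/t -/u.
- by rewrite S3_rep1; do 5 left.
- by do 4 left; right.
- by do 3 left; right.
- by rewrite !S3_repM; do 2 left; right.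
- by rewrite S3_repM; left; right.
- by rewrite S3_repM; right.
Qed.

Lemma setH_subgroup : is_subgroup (setH R).
Proof.
rewrite setH_range; split=> [|x y [s _ <-] [t _ <-]|x [s _ <-]].
- by exists 1%g; rewrite ?S3_rep1.
- by exists (s * t)%g; rewrite ?S3_repM.
exists s^-1%g => //.
have sV : S3_rep s * S3_rep s^-1%g = 1 by rewrite -S3_repM mulgV S3_rep1.
have Vs : S3_rep s^-1%g * S3_rep s = 1 by rewrite -S3_repM mulVg S3_rep1.
have u : S3_rep s \is a GRing.unit by apply/unitrP; exists (S3_rep s^-1%g); exact: conj Vs sV.
by apply: (mulrI u); rewrite sV divrr.
Qed.

Lemma setH_isom : group_isomorphic *%R *%g (setH R) [set: 'S_3].
Proof.
apply: (@group_isomorphic_inv _ _ _ _ _ _ S3_rep 1%g); last by [].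
split=> [|s t _ _]; last exact: S3_repM.
split=> [s _|s t _ _|x]; rewrite ?setH_range; first by exists s.
  exact: S3_rep_inj.
by move=> [s _ <-]; exists s.
Qed.

(** D differs from G_1 by a factor that belongs to N. *)
Lemma matD_groupG : groupG R (matD R).
Proof.
have -> : matD R = conjB (wdiag R 1 7 1) * G1.
  rewrite matD_conjB G1_conjB conjBM mono1E mulrA wdiagM.
  by rewrite (@wdiag1 R 9 9 9 isT isT isT) mul1r.
have [_ M _] := generated_subgroup [set G1; G2].
have g1 : groupG R G1 by apply: generated_incl; left.
have t171 : torus 1 7 1 by [].
have gw : groupG R (conjB (wdiag R 1 7 1)) := groupN_sub (groupN_wdiag t171).
exact: M gw g1.
Qed.

Lemma setH_sub : setH R `<=` groupG R.
Proof.
have [G_1 M _] := generated_subgroup [set G1; G2].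
have GD := matD_groupG.
have g1 : groupG R G1 by apply: generated_incl; left.
have g2 : groupG R G2 by apply: generated_incl; right.
have GW : groupG R (G1 * G2 * G1) := M _ _ (M _ _ g1 g2) g1.
move=> x [[[[[->|->]|->]|->]|->]|->].
- exact: G_1.
- exact: GD.
- exact: GW.
- exact: M (M _ _ GD GW) GD.
- exact: M GW GD.
- exact: M GD GW.
Qed.

Lemma groupN_setH x : groupN R x -> setH R x -> x = 1.
Proof.
rewrite setH_range => /groupNP[a [b [c [_ ->]]]] [s _ e].
by rewrite -e (wdiag_rep_eq1 (esym e)) S3_rep1.
Qed.

(** These factorizations of the generators into an element of N and an element of
H show that N H is the whole group. *)
Lemma G1_NH : G1 = conjB (wdiag R 8 2 8) * matD R.
Proof. by rewrite G1_conjB matD_conjB conjBM mono1E. Qed.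

Lemma G2_NH : G2 = conjB (wdiag R 8 8 2) * (matD R * (G1 * G2 * G1) * matD R).
Proof. by rewrite G121_conjB matD_conjB [LHS]G2_conjB !conjBM mono2E. Qed.

Lemma groupG_semidirect : is_semidirect_product (groupG R) (groupN R) (setH R)
  (fun H N => H * N * H^-1).
Proof.
apply: semidirect_product_generated.
- exact: unit_groupG.
- exact: groupN_normal.
- exact: setH_subgroup.
- exact: setH_sub.
- exact: groupN_setH.
move=> x [->|->].
  exists (conjB (wdiag R 8 2 8)), (matD R); split; last exact: G1_NH.
    exact: groupN_wdiag.
  by do 4 left; right.
exists (conjB (wdiag R 8 8 2)), (matD R * (G1 * G2 * G1) * matD R); split.
- exact: groupN_wdiag.
- by do 2 left; right.
- exact: G2_NH.
Qed.

End SubgroupH.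

(** * The group D(9,1,1;2,1,1) *)

Section GroupD.
Variable R : realType.
Local Notation C := R[i].
Local Notation G1 := (G1 R).
Local Notation G2 := (G2 R).
Local Notation DG := (D_group R 9 1 1 2 1 1).

Lemma D_EE : D_E R = monoD R * monoW R.
Proof.
rewrite /D_E /monoD /monoW mx3M.
by congr mx3; repeat congr cons; ring.
Qed.

Lemma D_FE : D_F R 9 1 1 = wdiag R 1 1 7.
Proof.
have w1 : expi (2 * 1 * pi / 9 : R) = omega R ^+ 1.
  by rewrite expr1 (@expi_zeta _ 8) //; field.
have w7 : expi (2 * (- 1 - 1) * pi / 9 : R) = omega R ^+ 7.
  have z0 : zeta R ^+ 16 != 0 by rewrite expf_neq0 ?zeta_neq0.
  rewrite (@expiN_zeta _ 16); last by field.
  apply: (mulIf z0); rewrite (mulVf z0) /omega -exprM -exprD.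
  by rewrite -[(_ + _)%N]/(36 * 2)%N exprM zeta36 sqrrN expr1n.
by rewrite /D_F w1 w7.
Qed.

Lemma D_GE : D_G R 2 1 1 = monoW R.
Proof.
have e1 : expi (2 * 1 * pi / 2 : R) = -1.
  by rewrite -expi_pi; congr expi; field.
have e2 : expi (2 * (- 1 - 1) * pi / 2 : R) = 1.
  rewrite (_ : 2 * (- 1 - 1) * pi / 2 = - pi + - pi); last by field.
  by rewrite expiD expiN expi_pi invrN invr1 mulrNN mulr1.
by rewrite /D_G e1 e2.
Qed.

Lemma D_groupE : DG = generated [set monoD R * monoW R; wdiag R 1 1 7; monoW R].
Proof. by rewrite /D_group D_EE D_FE D_GE. Qed.

Lemma monoW_sq : monoW R * monoW R = 1.
Proof. by rewrite /monoW mx3M mx3_1; congr mx3; repeat congr cons; ring. Qed.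

Lemma monoW_wdiag a b c : monoW R * wdiag R a b c = wdiag R a c b * monoW R.
Proof.
rewrite /monoW /wdiag /diag3 !mx3M; move: (omega R) => o.
by congr mx3; repeat congr cons; ring.
Qed.

Lemma conjBV (A : 'M[C]_3) : (conjB A)^-1 = conjB A^-1.
Proof.
have [uA|nuA] := boolP (A \is a GRing.unit).
  have ucA := conjB_unit uA.
  by apply: (mulrI ucA); rewrite divrr // conjBM divrr // conjB1.
rewrite !invr_out //; apply: contra nuA => /conjB_unit.
by rewrite conjBK.
Qed.

Lemma conjB_preimage_subgroup (K : set 'M[C]_3) :
  is_subgroup K -> is_subgroup [set A | K (conjB A)].
Proof.
move=> [K1 KM KV]; split=> [|A B KA KB|A KA] /=; first by rewrite conjB1.
  by rewrite -conjBM; apply: KM.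
by rewrite -conjBV; apply: KV.
Qed.

Lemma groupG_conjB A : groupG R A -> DG (conjB A).
Proof.
have sD : is_subgroup DG := generated_subgroup _.
have [_ M _] := sD.
have DE : DG (monoD R * monoW R) by rewrite D_groupE; apply: generated_incl; left; left.
have DF : DG (wdiag R 1 1 7) by rewrite D_groupE; apply: generated_incl; left; right.
have DW : DG (monoW R) by rewrite D_groupE; apply: generated_incl; right.
have DD : DG (monoD R).
  by have := M _ _ DE DW; rewrite -mulrA monoW_sq mulr1.
have F8 : wdiag R 8 8 2 = wdiag R 1 1 7 ^+ 8.
  by apply/eqP; rewrite wdiagX eq_wdiag.
(* With F = wdiag 1 1 7, mono1 = monoW F^8 monoW monoD and
   mono2 = F^8 monoD monoW monoD. *)
have DF8 : DG (wdiag R 8 8 2) by rewrite F8; exact: subgroupX 8 sD DF.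
move: A; apply: (generated_min (conjB_preimage_subgroup sD)) => A [->|->] /=.
  rewrite G1_conjB conjBK mono1E -[wdiag R 8 2 8]mulr1 -monoW_sq mulrA -monoW_wdiag.
  exact: M (M _ _ (M _ _ DW DF8) DW) DD.
rewrite G2_conjB conjBK mono2E.
exact: M DF8 (M _ _ (M _ _ DD DW) DD).
Qed.

Lemma D_group_conjB A : DG A -> groupG R (conjB A).
Proof.
have sG : is_subgroup (groupG R) := generated_subgroup _.
have [_ M _] := sG.
have GD : groupG R (conjB (monoD R)) by rewrite -matD_conjB; apply: matD_groupG.
have GW : groupG R (conjB (monoW R)).
  rewrite -G121_conjB; apply: setH_sub; do 3 left; by right.
have t117 : torus 1 1 7 by [].
move: A; rewrite D_groupE; apply: (generated_min (conjB_preimage_subgroup sG)).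
move=> A [[->|->]|->] /=; last exact: GW.
  by rewrite -conjBM; exact: M GD GW.
exact: groupN_sub (groupN_wdiag t117).
Qed.

Lemma groupG_D_group : group_isomorphic *%R *%R (groupG R) DG.
Proof.
exists (@conjB R); split; last by move=> x y _ _; rewrite conjBM.
split=> [A /groupG_conjB //|A B _ _ /(inv_inj (@conjBK R)) //|A DA].
by exists (conjB A); [exact: D_group_conjB | exact: conjBK].
Qed.

End GroupD.

(** * Crossingless matchings as sequences *)

(** A matching is encoded by the list of the partners of 0, 1, ..., n-1. The default
value k mirrors the convention that [partner] fixes the numbers outside the
range, so that the two functions agree everywhere ([partner_of_code]). *)
Definition partner_of (s : seq nat) (k : nat) : nat := nth k s k.

Definition matching_code n (m : matching n) : seq nat := mkseq (partner m) n.

Lemma partner_ord n (m : matching n) (i : 'I_n) : partner m i = val m i.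
Proof. by rewrite /partner insubT //= => lti; congr (nat_of_ord (_ _)); apply/val_inj. Qed.

Lemma partner_of_code n (m : matching n) : partner_of (matching_code m) = partner m.
Proof.
apply/funext => k; rewrite /partner_of; have [ltkn|lenk] := ltnP k n.
  by rewrite nth_mkseq.
by rewrite nth_default ?size_mkseq // /partner insubF // ltnNge lenk.
Qed.

(** The conditions for being a matching, as far as they concern the first entries
only. They are inherited by shorter prefixes, so that all codes can be enumerated
entry by entry, without running through all n^n lists. *)
Definition prefix_ok n (s : seq nat) : bool :=
  all (fun i => let p := nth 0%N s i in
    [&& p < n, p != i, (p < size s) ==> (nth 0 s p == i)
      & all (fun j => ~~ [&& i < j, j < p & p < nth 0 s j]) (iota 0 (size s))])%N
    (iota 0 (size s)).

Fixpoint prefixes n k : seq (seq nat) :=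
  if k is k'.+1 then
    [seq t <- [seq rcons s x | s <- prefixes n k', x <- iota 0 n]
       | prefix_ok n t]
  else [:: [::]].

Definition matching_codes n := prefixes n n.

Lemma prefix_okP n s : reflect
  (forall i, (i < size s)%N -> [/\ (nth 0 s i < n)%N, nth 0%N s i != i,
     (nth 0 s i < size s)%N -> nth 0%N s (nth 0%N s i) = i
     & forall j, (j < size s)%N ->
         ~~ [&& i < j, j < nth 0 s i & nth 0 s i < nth 0 s j]%N])
  (prefix_ok n s).
Proof.
apply: (iffP allP) => [H i lti|H i].
  have /H/and4P[? ? h1 /allP h2] : i \in iota 0 (size s) by rewrite mem_iota.
  split=> // [lt|j ltj]; first by move: h1; rewrite lt => /eqP.
  by apply: h2; rewrite mem_iota.
rewrite mem_iota /= => /H[-> -> h1 h2] /=.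
apply/andP; split; first by apply/implyP => /h1/eqP.
by apply/allP => j; rewrite mem_iota => /h2.
Qed.

Lemma prefix_ok_take n k s : prefix_ok n s -> prefix_ok n (take k s).
Proof.
move=> /prefix_okP ok; apply/prefix_okP => i.
rewrite size_take_min leq_min => /andP[ltik ltis].
have [h1 h2 h3 h4] := ok i ltis.
rewrite nth_take //; split=> // [|j].
  by rewrite leq_min => /andP[? ?]; rewrite nth_take // h3.
by rewrite leq_min => /andP[? ?]; rewrite nth_take // h4.
Qed.

Lemma mem_matching_codes n s : (s \in matching_codes n) = (size s == n) && prefix_ok n s.
Proof.
suff main k : (k <= n)%N -> forall t,
    (t \in prefixes n k) = (size t == k) && prefix_ok n t by exact: main.
elim: k => [|k IHk] lekn t; first by rewrite inE -size_eq0; case: t.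
rewrite mem_filter andbC; apply/andP/andP => -[].
  move=> /allpairsP[[u x] /= [+ _ ->]] ->.
  by rewrite IHk 1?ltnW // size_rcons => /andP[/eqP-> _].
move=> /eqP st okt; split=> //.
have ltk : (k < size t)%N by rewrite st.
have tE : t = rcons (take k t) (nth 0%N t k) by rewrite -take_nth // -st take_size.
rewrite tE; apply: allpairs_f; last first.
  by have /prefix_okP/(_ k ltk)[+ _ _ _] := okt; rewrite mem_iota.
by rewrite IHk 1?ltnW // size_takel 1?ltnW // eqxx prefix_ok_take.
Qed.

Lemma code_in_codes n (m : matching n) : matching_code m \in matching_codes n.
Proof.
rewrite mem_matching_codes size_mkseq eqxx; apply/prefix_okP => i.
rewrite size_mkseq => lti; have := valP m => /andP[/forallP inv /forallP nc].
have /andP[] := inv (Ordinal lti); rewrite -!val_eqE /= => ne iv.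
have pE (j : 'I_n) : nth 0%N (matching_code m) j = (val m j : 'I_n).
  by rewrite nth_mkseq // partner_ord.
rewrite (pE (Ordinal lti)); split=> // [_|j ltj]; first by rewrite pE (eqP iv).
by rewrite (pE (Ordinal ltj)); have /forallP/(_ (Ordinal ltj)) := nc (Ordinal lti).
Qed.

Lemma matching_codesP n s :
  s \in matching_codes n -> exists m : matching n, matching_code m = s.
Proof.
rewrite mem_matching_codes => /andP[/eqP szs /prefix_okP]; rewrite szs => ok.
pose f := [ffun i : 'I_n => odflt i (insub (nth 0%N s i))].
have fE i : val (f i) = nth 0%N s i.
  by rewrite ffunE; have [lt _ _ _] := ok i (ltn_ord i); rewrite insubT.
have fP : crossingless f.
  apply/andP; split; apply/forallP => i.
    have [lt ne iv _] := ok i (ltn_ord i).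
    by rewrite -!val_eqE /= !fE ne iv ?eqxx.
  apply/forallP => j; have [_ _ _] := ok i (ltn_ord i).
  by move=> /(_ j (ltn_ord j)); rewrite -!fE.
exists (exist _ f fP); apply: (@eq_from_nth _ 0%N); rewrite size_mkseq // => i lti.
by rewrite nth_mkseq // (partner_ord _ (Ordinal lti)) /= fE.
Qed.

(** * Counting loops *)

Lemma n_comp_label (T : finType) (D : eqType) (e : rel T) (f : T -> D) :
    connect_sym e -> (forall x y, e x y -> f x = f y) ->
    (forall x y, f x = f y -> connect e x y) ->
  n_comp e predT = size (undup [seq f x | x <- enum T]).
Proof.
move=> esym fe fc.
have fconn x y : connect e x y -> f x = f y.
  move=> /connectP[p pth ->]; elim: p x pth => //= z p IHp x /andP[xz pth].
  by rewrite (fe _ _ xz) IHp.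
rewrite /n_comp_mem cardE.
rewrite -(size_map f); apply/perm_size/uniq_perm; last 1 first.
- move=> d; rewrite mem_undup; apply/mapP/mapP => -[x xT ->].
    by exists x; rewrite ?mem_enum.
  exists (fingraph.root e x); first by rewrite mem_enum inE /= fingraph.roots_root.
  by apply: fconn; rewrite fingraph.connect_root.
- rewrite map_inj_in_uniq ?enum_uniq // => x y.
  rewrite !mem_enum !inE !andbT => /eqP rx /eqP ry /fc.
  by rewrite -{2}rx -{2}ry; apply/fingraph.rootP.
- exact: undup_uniq.
Qed.

(** Following the arcs of s and t alternately from x runs through the whole loop
of x; the least point that is met labels the loop. *)
Definition loop_walk (s t : seq nat) (x : nat) : seq nat :=
  let w := traject (partner_of t \o partner_of s) x (size s) in w ++ map (partner_of s) w.

Definition loop_label (s t : seq nat) (x : nat) : nat := foldr minn x (loop_walk s t x).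

(** The walk does stay in the component of x by its construction. That it reaches
all of it is this condition, which is verified by computation. *)
Definition loop_label_invariant (s t : seq nat) : bool :=
  all (fun x => (loop_label s t (partner_of s x) == loop_label s t x)
             && (loop_label s t (partner_of t x) == loop_label s t x)) (iota 0 (size s)).

Definition loop_count (s t : seq nat) : nat :=
  size (undup [seq loop_label s t x | x <- iota 0 (size s)]).

Lemma loops_code n (a b : matching n) :
  loop_label_invariant (matching_code a) (matching_code b) ->
  loops a b = loop_count (matching_code a) (matching_code b).
Proof.
move=> /allP inv; rewrite /loops.
set e := (X in n_comp X _).
have pa (m : matching n) (i : 'I_n) : partner_of (matching_code m) i = val m i.
  by rewrite partner_of_code partner_ord.
have invo (m : matching n) i : val m (val m i) = i.
  by have /andP[/forallP/(_ i)/andP[_ /eqP]] := valP m.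
have esym : connect_sym e.
  apply: sym_connect_sym => i j; rewrite /e /=.
  have sw (m : matching n) : (j == val m i) = (i == val m j).
    by apply/eqP/eqP => ->; rewrite invo.
  by rewrite (sw a) (sw b).
have cwalk (x : 'I_n) k : k \in loop_walk (matching_code a) (matching_code b) x ->
    exists2 z : 'I_n, connect e x z & val z = k.
  have ctraj r l (y : 'I_n) :
      l \in traject (partner_of (matching_code b) \o partner_of (matching_code a)) y r ->
      exists2 z : 'I_n, connect e y z & val z = l.
    elim: r y => [|r IHr] y //=; rewrite inE => /predU1P[-> | ].
      by exists y; rewrite ?connect0.
    rewrite !pa => /IHr[z yz <-]; exists z => //.
    apply: connect_trans yz; apply: (@connect_trans _ _ (val a y)).
      by apply: connect1; rewrite /e /= eqxx.
    by apply: connect1; rewrite /e /= eqxx orbT.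
  rewrite mem_cat size_mkseq => /orP[/ctraj// | /mapP[l /ctraj[z xz <-] ->]].
  exists (val a z); last by rewrite pa.
  by apply: (connect_trans xz); apply: connect1; rewrite /e /= eqxx.
have clabel (x : 'I_n) : exists2 z : 'I_n,
    connect e x z & val z = loop_label (matching_code a) (matching_code b) x.
  rewrite /loop_label; elim: (loop_walk _ _ _) (@cwalk x) => [|k w IHw] cw /=.
    by exists x; rewrite ?connect0.
  rewrite /minn; case: ifP => _; first by apply: cw; rewrite inE eqxx.
  by apply: IHw => l lw; apply: cw; rewrite inE lw orbT.
rewrite (@n_comp_label _ _ _
  (fun x : 'I_n => loop_label (matching_code a) (matching_code b) x)) //.
- by rewrite /loop_count size_mkseq -val_enum_ord -map_comp.
- move=> x y; have /inv/andP[/eqP la /eqP lb] : (x : nat) \in iota 0 (size (matching_code a)).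
    by rewrite size_mkseq mem_iota leq0n ltn_ord.
  by rewrite !pa /= in la lb; move=> /= /orP[] /eqP ->.
- move=> x y lxy; have [z xz zE] := clabel x; have [t yt tE] := clabel y.
  have /val_inj ztE : val z = val t by rewrite zE lxy tE.
  by apply: (connect_trans xz); rewrite ztE esym.
Qed.

(** * Linear algebra in the matching space *)

Section LinearMaps.
Variables (K : pzRingType) (V W : lmodType K) (f : V -> W).
Hypothesis linf : linear f.

Lemma lin_map0 : f 0 = 0.
Proof. by have := linf (-1) 0 0; rewrite scaler0 addr0 scaleN1r addNr. Qed.

Lemma lin_mapD x y : f (x + y) = f x + f y.
Proof. by rewrite -{1}[x]scale1r linf scale1r. Qed.

Lemma lin_mapZ a x : f (a *: x) = a *: f x.
Proof. by rewrite -{1}[a *: x]addr0 linf lin_map0 addr0. Qed.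

Lemma lin_map_sum (I : finType) (F : I -> V) : f (\sum_i F i) = \sum_i f (F i).
Proof. exact: (big_morph _ lin_mapD lin_map0). Qed.

End LinearMaps.

Section MatchingSpace.
Variable R : realType.
Local Notation C := R[i].

(** For a valid code this is the corresponding element of the diagram basis. *)
Definition diagram n (s : seq nat) : matching_space R n := basis_vec R n (partner_of s).

Lemma eq_basis_vec n (p q : nat -> nat) : (forall i, (i < n)%N -> p i = q i) ->
  basis_vec R n p = basis_vec R n q.
Proof.
move=> epq; apply/ffunP => m; rewrite !ffunE; congr (_%:R).
by congr (nat_of_bool _); apply: eq_forallb => i; rewrite epq.
Qed.

Lemma diagram_code n (m m' : matching n) : diagram n (matching_code m) m' = (m' == m)%:R.
Proof.
rewrite ffunE; congr (_%:R); congr (nat_of_bool _).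
apply/forallP/eqP => [H|-> i]; last by rewrite partner_of_code.
apply/val_inj/ffunP => i; apply/val_inj => /=.
by rewrite -!partner_ord (eqP (H i)) partner_of_code.
Qed.

Lemma diagram_sum n (x : matching_space R n) : x = \sum_m x m *: diagram n (matching_code m).
Proof.
apply/ffunP => m; rewrite sum_ffunE (bigD1 m) //= big1 => [|i im].
  by rewrite ffunE diagram_code eqxx addr0 /GRing.scale /= mulr1.
by rewrite ffunE diagram_code eq_sym (negPf im) /GRing.scale /= mulr0.
Qed.

Lemma lin_ext_diagram n k (f : matching n -> matching_space R k) m :
  lin_ext f (diagram n (matching_code m)) = f m.
Proof.
rewrite /lin_ext (bigD1 m) //= big1 => [|i im].
  by rewrite diagram_code eqxx addr0 scale1r.
by rewrite diagram_code (negPf im) scale0r.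
Qed.

Lemma lin_ext_linear n k (f : matching n -> matching_space R k) :
  linear (lin_ext f).
Proof.
move=> a x y; rewrite /lin_ext scaler_sumr -big_split /=.
by apply: eq_bigr => m _; rewrite !ffunE scalerDl scalerA.
Qed.

Lemma u_diagram n j (s : seq nat) : s \in matching_codes n ->
  u_ j (diagram n s) = if partner_of s j.-1 == j then delta R *: diagram n s
                  else diagram n (mkseq (cupcap_fun j.-1 (partner_of s)) n).
Proof.
move=> /matching_codesP[m <-]; rewrite /u_ lin_ext_diagram /diagram !partner_of_code.
case: ifP => // _.
by apply: eq_basis_vec => i lti; rewrite /partner_of nth_mkseq.
Qed.

Lemma cup_diagram n a (s : seq nat) : s \in matching_codes n ->
  cup a (diagram n s) = diagram n.+2 (mkseq (cup_fun a (partner_of s)) n.+2).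
Proof.
move=> /matching_codesP[m <-]; rewrite /cup lin_ext_diagram /diagram !partner_of_code.
by apply: eq_basis_vec => i lti; rewrite /partner_of nth_mkseq.
Qed.

Lemma u_linear n j : linear (@u_ R n j). Proof. exact: lin_ext_linear. Qed.
Lemma cup_linear n a : linear (@cup R n a). Proof. exact: lin_ext_linear. Qed.

Lemma JWS N s n (x : matching_space R N) :
  JW s n.+2 x = JW s n.+1 x -
    (Delta R n / Delta R n.+1) *: JW s n.+1 (u_ (s + n.+1) (JW s n.+1 x)).
Proof. by []. Qed.

Lemma JW_linear N s n : linear (@JW R N s n).
Proof.
elim: n => [|[|n] IHn] a x y //.
have lin2 (c : C) (p q p' q' : matching_space R N) :
    a *: p + q - c *: (a *: p' + q') = a *: (p - c *: p') + (q - c *: q').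
  by rewrite scalerDr scalerBr !scalerA [c * a]mulrC opprD addrACA.
by rewrite !JWS IHn u_linear IHn lin2.
Qed.

End MatchingSpace.

(** * Exact arithmetic in the field generated by the Kauffman variable *)

Fixpoint add_padded (T : Type) (op : T -> T -> T) (s t : seq T) : seq T :=
  match s, t with
  | x :: s', y :: t' => op x y :: add_padded op s' t'
  | [::], _ => t
  | _, [::] => s
  end.

(** A list x_0, ..., x_7 of rational numbers stands for the element x_0 + x_1 A +
... + x_7 A^7 of Q(A), and shorter lists are padded with zeros. *)
Definition cyc_add : seq rat -> seq rat -> seq rat := add_padded +%R.

Definition cyc_scale (a : rat) (x : seq rat) : seq rat :=
  if a == 0 then [::] else map ( *%R a) x.

(** Multiplication by A, reduced by A^8 = A^4 - 1. *)
Definition cyc_shift (x : seq rat) : seq rat :=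
  if x is [:: x0; x1; x2; x3; x4; x5; x6; x7]
  then [:: - x7; x0; x1; x2; x3 + x7; x4; x5; x6] else 0 :: x.

Definition cyc_mul (x y : seq rat) : seq rat :=
  foldr (fun a z => cyc_add (cyc_scale a y) (cyc_shift z)) [::] x.

Definition cyc_exp (x : seq rat) (n : nat) : seq rat := iter n (cyc_mul x) [:: 1].

(** The inverse of A, since A (A^3 - A^7) = A^4 - A^8 = 1. *)
Definition cyc_invA : seq rat := [:: 0; 0; 0; 1; 0; 0; 0; -1].

(** Complex conjugation maps A to its inverse; this is Horner's rule at that
point. *)
Definition cyc_conj (x : seq rat) : seq rat :=
  foldr (fun a z => cyc_add [:: a] (cyc_mul cyc_invA z)) [::] x.

Definition cyc_eq (x y : seq rat) : bool := all (pred1 0) (cyc_add x (cyc_scale (-1) y)).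

Section Eval.
Variable R : realType.
Local Notation A := (Akauf R).

Definition cyc_eval (x : seq rat) : R[i] := foldr (fun a z => ratr a + A * z) 0 x.

Lemma eval_add x y : cyc_eval (cyc_add x y) = cyc_eval x + cyc_eval y.
Proof.
elim: x y => [|a x IHx] [|b y] /=; rewrite ?add0r ?addr0 //.
by rewrite -/(cyc_add x y) IHx rmorphD /=; ring.
Qed.

Lemma eval_scale a x : cyc_eval (cyc_scale a x) = ratr a * cyc_eval x.
Proof.
rewrite /cyc_scale; case: eqP => [->|_]; first by rewrite rmorph0 mul0r.
elim: x => [|b x IHx] /=; first by rewrite mulr0.
by rewrite IHx rmorphM /=; ring.
Qed.

Lemma eval_shift x : cyc_eval (cyc_shift x) = A * cyc_eval x.
Proof.
have ev_cons0 y : cyc_eval (0 :: y) = A * cyc_eval y by rewrite /= rmorph0 add0r.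
case: x => [|x0 [|x1 [|x2 [|x3 [|x4 [|x5 [|x6 [|x7 [|x8 x]]]]]]]]]; try exact: ev_cons0.
by rewrite /= rmorphN rmorphD /= ; ring: (Akauf8 R).
Qed.

Lemma eval_mul x y : cyc_eval (cyc_mul x y) = cyc_eval x * cyc_eval y.
Proof.
elim: x => [|a x IHx] /=; first by rewrite mul0r.
by rewrite eval_add eval_scale eval_shift IHx; ring.
Qed.

Lemma cyc_eval1 : cyc_eval [:: 1] = 1.
Proof. by rewrite /= mulr0 addr0 rmorph1. Qed.

Lemma eval_exp x n : cyc_eval (cyc_exp x n) = cyc_eval x ^+ n.
Proof. by elim: n => [|n IHn]; [exact: cyc_eval1 | rewrite exprS -IHn -eval_mul]. Qed.

Lemma cyc_eqP x y : cyc_eq x y -> cyc_eval x = cyc_eval y.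
Proof.
move=> xy; apply/eqP; rewrite -subr_eq0 -mulN1r; apply/eqP.
have -> : -1 = ratr (-1) :> R[i] by rewrite rmorphN rmorph1.
rewrite -eval_scale -eval_add; move: xy; rewrite /cyc_eq.
elim: (cyc_add _ _) => //= a z IHz /andP[/eqP-> /IHz->].
by rewrite rmorph0 mulr0 addr0.
Qed.

Lemma eval_invA : cyc_eval cyc_invA = A^-1.
Proof.
have A1 : cyc_eval [:: 0; 1] = A by rewrite /= rmorph0 rmorph1; ring.
have AV : A * cyc_eval cyc_invA = 1.
  by rewrite -{1}A1 -eval_mul -cyc_eval1; apply: cyc_eqP.
have A0 : A != 0 by apply/eqP => A0; move/eqP: AV; rewrite A0 mul0r eq_sym oner_eq0.
by apply: (mulfI A0); rewrite AV mulfV.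
Qed.

Lemma conj_Akauf : A^* = A^-1.
Proof. by rewrite Akauf_zeta rmorphXn /= conj_zeta exprVn. Qed.

Lemma eval_conj x : cyc_eval (cyc_conj x) = (cyc_eval x)^*.
Proof.
elim: x => [|a x IHx]; first by rewrite rmorph0.
rewrite -[cyc_conj _]/(cyc_add [:: a] (cyc_mul cyc_invA (cyc_conj x))).
rewrite eval_add eval_mul eval_invA IHx /= mulr0 addr0 [RHS]rmorphD.
congr (_ + _); first by rewrite [RHS]fmorph_rat.
by rewrite [RHS]rmorphM /= conj_Akauf.
Qed.

(** A^-2 = A^2 - A^6, hence - A^2 - A^-2 = A^6 - 2 A^2. *)
Definition cyc_delta : seq rat := [:: 0; 0; -2; 0; 0; 0; 1].

Lemma eval_delta : cyc_eval cyc_delta = delta R.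
Proof.
rewrite /delta -exprVn -eval_invA -eval_exp.
have -> : - A ^+ 2 = cyc_eval [:: 0; 0; -1].
  by rewrite /= !rmorph0 rmorphN rmorph1; ring.
have -> : - cyc_eval (cyc_exp cyc_invA 2) = cyc_eval (cyc_scale (-1) (cyc_exp cyc_invA 2)).
  by rewrite eval_scale rmorphN rmorph1 mulN1r.
by rewrite -eval_add; apply: cyc_eqP.
Qed.

(** A^3 is a primitive 8th root of unity with negative real part, so that sqrt 2 =
- (A^3 + A^-3) = A^5 - A^3 - A. *)
Definition cyc_sqrt2 : seq rat := [:: 0; -1; 0; -1; 0; 1].

Lemma eval_sqrt2 : cyc_eval cyc_sqrt2 = (Num.sqrt 2 : R)%:C%C.
Proof.
have z0 := @zeta_neq0 R.
rewrite sqrt2_zeta /= Akauf_zeta !rmorph0 !rmorphN !rmorph1.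
apply: (mulfI (expf_neq0 9 z0)).
rewrite [RHS]mulrDr mulfV ?expf_neq0 //; ring: (zeta24 R).
Qed.

(** delta = 2 cos(pi/6). *)
Lemma cyc_delta_ge0 : 0 <= cyc_eval cyc_delta.
Proof.
have A2 : A ^+ 2 = - expi (- (pi / 6)).
  rewrite expiN Akauf_zeta (@expi_zeta _ 6); last by field.
  have z6 : zeta R ^+ 6 != 0 by rewrite expf_neq0 ?zeta_neq0.
  have e : (zeta R ^+ 15) ^+ 2 * zeta R ^+ 6 = -1 by rewrite -(zeta36 R); ring.
  by apply: (mulIf z6); rewrite e mulNr mulVf.
rewrite eval_delta /delta A2 invrN -expiN !opprK addrC.
rewrite -conj_expi /expi lecE /= subrr eqxx /= -mulr2n mulrn_wge0 //.
by apply: cos_ge0_pihalf; have := pi_gt0 R; move=> ?; apply/andP; split; lra.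
Qed.

(** The coefficients Delta_n / Delta_(n+1) of the Jones-Wenzl recursion: as delta^2
= 3, the numbers Delta_0, ..., Delta_3 are 1, delta, 2, delta. *)
Definition cyc_ratio (n : nat) : seq rat :=
  cyc_scale (nth 0 [:: 1 / 3; 1 / 2; 2 / 3] n) cyc_delta.

Lemma Delta_ratio n : (n < 3)%N -> Delta R n / Delta R n.+1 = cyc_eval (cyc_ratio n).
Proof.
have d2 : delta R * delta R = 3.
  rewrite -eval_delta -eval_mul (@cyc_eqP _ [:: 3]) //=.
  by rewrite mulr0 addr0 ratr_nat.
have d0 : delta R != 0.
  by apply/eqP => d0; move/eqP: d2; rewrite d0 mul0r eq_sym pnatr_eq0.
have dV : (delta R)^-1 = delta R / 3.
  by apply: (mulfI d0); rewrite mulfV // mulrA d2 mulfV ?pnatr_eq0.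
have D2 : Delta R 2 = 2 by rewrite /= d2; ring.
have D3 : Delta R 3 = delta R by rewrite -[LHS]/(delta R * Delta R 2 - delta R) D2; ring.
have eval_ratio (p q : nat) :
    cyc_eval (cyc_scale (p%:R / q%:R) cyc_delta) = p%:R / q%:R * delta R.
  by rewrite eval_scale eval_delta rmorphM fmorphV !rmorph_nat.
case: n => [|[|[|n]]] // _; rewrite ?D3 ?D2.
- by rewrite (eval_ratio 1 3)%N -[Delta R 0]/1 -[Delta R 1]/(delta R) dV; field.
- by rewrite (eval_ratio 1 2)%N -[Delta R 1]/(delta R); field.
- by rewrite (eval_ratio 2 3)%N dV; field.
Qed.

End Eval.

(** * Vectors of M_8 and the operators on them *)

(** The 14 crossingless matchings of 8 points, in lexicographic order. Vectors of
M_8 are lists of coefficients in this order. *)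
Definition codes8 : seq (seq nat) := Eval vm_compute in matching_codes 8.

Lemma codes8E : codes8 = matching_codes 8.
Proof. by vm_compute. Qed.

Lemma loop_label_invariant_codes8 :
  all (fun s => all (loop_label_invariant s) codes8) codes8.
Proof. by vm_compute. Qed.

Lemma cupcap_codes8 : all (fun j => all (fun s => (partner_of s j.-1 == j) ||
    (mkseq (cupcap_fun j.-1 (partner_of s)) 8 \in codes8)) codes8) (iota 1 7).
Proof. by vm_compute. Qed.

#[local] Opaque codes8.

Definition vadd : seq (seq rat) -> seq (seq rat) -> seq (seq rat) := add_padded cyc_add.

Definition vscale (c : seq rat) (v : seq (seq rat)) : seq (seq rat) :=
  map (cyc_mul c) v.

Definition veq (v w : seq (seq rat)) : bool :=
  all (all (pred1 0)) (vadd v (vscale [:: -1] w)).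

Definition vunit (c : seq rat) (k : nat) : seq (seq rat) := ncons k [::] [:: c].

(** The linear map that sends the diagram of each s in S to f s. *)
Definition vlin (f : seq nat -> seq (seq rat)) (S : seq (seq nat))
    (v : seq (seq rat)) : seq (seq rat) :=
  foldr (fun p w => vadd (vscale p.1 (f p.2)) w) [::] (zip v S).

Definition vu (j : nat) : seq (seq rat) -> seq (seq rat) :=
  vlin (fun s =>
    if partner_of s j.-1 == j then vunit cyc_delta (index s codes8)
    else vunit [:: 1] (index (mkseq (cupcap_fun j.-1 (partner_of s)) 8) codes8))
  codes8.

Fixpoint vJW (s n : nat) (v : seq (seq rat)) : seq (seq rat) :=
  match n with
  | 0 | 1 => v
  | (j.+1 as k).+1 =>
      let w := vJW s k v in
      vadd w (vscale (cyc_scale (-1) (cyc_ratio j)) (vJW s k (vu (s + k) w)))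
  end.

Definition vf2222 (v : seq (seq rat)) : seq (seq rat) :=
  vJW 0 2 (vJW 2 2 (vJW 4 2 (vJW 6 2 v))).

Definition vsigma (j : nat) (v : seq (seq rat)) : seq (seq rat) :=
  vadd (vscale [:: 0; 1] v) (vscale cyc_invA (vu j v)).

Definition vrho (i : nat) (v : seq (seq rat)) : seq (seq rat) :=
  vsigma (2 * i) (vsigma (2 * i).-1 (vsigma (2 * i).+1 (vsigma (2 * i) v))).

(** The linear functional that takes the value F s on the diagram of each s in S. *)
Definition cyc_sum (F : seq nat -> seq rat) (S : seq (seq nat)) (v : seq (seq rat)) :
    seq rat :=
  foldr (fun p z => cyc_add (cyc_mul p.1 (F p.2)) z) [::] (zip v S).

(** The form is conjugate-linear in its first argument, which is why the functional
is conjugated before and after. *)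
Definition vpairing (v w : seq (seq rat)) : seq rat :=
  cyc_conj (cyc_sum (fun s =>
      cyc_conj (cyc_sum (fun t => cyc_exp cyc_delta (loop_count s t)) codes8 w))
    codes8 v).

Section Vec.
Variable R : realType.
Local Notation A := (Akauf R).
Local Notation M8 := (matching_space R 8).

Definition lincomb (S : seq (seq nat)) (v : seq (seq rat)) : M8 :=
  \sum_(p <- zip v S) cyc_eval R p.1 *: diagram R 8 p.2.

Definition vec : seq (seq rat) -> M8 := lincomb codes8.

Lemma lincomb_cons s S c v :
  lincomb (s :: S) (c :: v) = cyc_eval R c *: diagram R 8 s + lincomb S v.
Proof. by rewrite /lincomb /= big_cons. Qed.

Lemma lincomb_nil S : lincomb S [::] = 0.
Proof. by rewrite /lincomb; case: S => [|? ?]; rewrite big_nil. Qed.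

Lemma lincomb0 v : lincomb [::] v = 0.
Proof. by rewrite /lincomb; case: v => [|? ?]; rewrite big_nil. Qed.

Lemma lincomb_vadd S v w : lincomb S (vadd v w) = lincomb S v + lincomb S w.
Proof.
elim: S v w => [|s S IHS] v w; first by rewrite !lincomb0 addr0.
case: v w => [|c v] [|d w]; rewrite ?lincomb_nil ?add0r ?addr0 //.
by rewrite /= !lincomb_cons -/(vadd v w) IHS eval_add scalerDl addrACA.
Qed.

Lemma lincomb_vscale S c v : lincomb S (vscale c v) = cyc_eval R c *: lincomb S v.
Proof.
elim: S v => [|s S IHS] [|d v]; rewrite ?lincomb_nil ?lincomb0 ?scaler0 //.
by rewrite /= !lincomb_cons -/(vscale c v) IHS eval_mul scalerDr scalerA.
Qed.

Lemma vecD v w : vec (vadd v w) = vec v + vec w.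
Proof. exact: lincomb_vadd. Qed.

Lemma vecZ c v : vec (vscale c v) = cyc_eval R c *: vec v.
Proof. exact: lincomb_vscale. Qed.

Lemma cyc_eval_all0 x : all (pred1 0) x -> cyc_eval R x = 0.
Proof. by elim: x => //= a x IHx /andP[/eqP-> /IHx->]; rewrite rmorph0 mulr0 addr0. Qed.

Lemma veqP v w : veq v w -> vec v = vec w.
Proof.
move=> vw; apply/eqP; rewrite -subr_eq0 -scaleN1r.
have -> : -1 = cyc_eval R [:: -1] by rewrite /= rmorphN rmorph1 mulr0 addr0.
rewrite -vecZ -vecD /vec; apply/eqP; move: vw; rewrite /veq.
elim: codes8 (vadd _ _) => [|s S IHS] [|c x]; rewrite ?lincomb0 ?lincomb_nil //=.
by move=> /andP[/cyc_eval_all0 c0 /IHS x0]; rewrite lincomb_cons c0 x0 scale0r addr0.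
Qed.

Lemma lincomb_vunit S c k : (k < size S)%N ->
  lincomb S (vunit c k) = cyc_eval R c *: diagram R 8 (nth [::] S k).
Proof.
elim: S k => [|s S IHS] [|k] // ltk; rewrite /vunit /= lincomb_cons.
  by rewrite lincomb_nil addr0.
by rewrite /= scale0r add0r -/(vunit c k) IHS.
Qed.

Lemma vec_vunit c s : s \in codes8 ->
  vec (vunit c (index s codes8)) = cyc_eval R c *: diagram R 8 s.
Proof.
move=> sC; have lt : (index s codes8 < size codes8)%N by rewrite index_mem.
by rewrite /vec (lincomb_vunit c lt) nth_index.
Qed.

Lemma vlinP (L : M8 -> M8) f S v : linear L ->
    (forall s, s \in S -> L (diagram R 8 s) = vec (f s)) ->
  L (lincomb S v) = vec (vlin f S v).
Proof.
move=> linL.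
have L0 : L 0 = 0 := lin_map0 linL.
elim: S v => [|s S IHS] v Lf.
  by rewrite lincomb0 L0 /vlin; case: v => [|? ?]; rewrite /vec lincomb_nil.
case: v => [|c v]; first by rewrite lincomb_nil L0 /vec lincomb_nil.
rewrite lincomb_cons linL Lf ?inE ?eqxx // IHS; last first.
  by move=> t tS; apply: Lf; rewrite inE tS orbT.
by rewrite -vecZ -vecD.
Qed.

Lemma vec_vu j v : (0 < j < 8)%N -> u_ j (vec v) = vec (vu j v).
Proof.
move=> /andP[j0 j8]; apply: vlinP => [|s sC]; first exact: u_linear.
rewrite u_diagram -?codes8E //; case: ifP => [_|jj]; first by rewrite vec_vunit // eval_delta.
have /allP/(_ j) := cupcap_codes8; rewrite mem_iota j0 j8 => /(_ isT)/allP/(_ s sC).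
by rewrite jj /= => tC; rewrite vec_vunit // cyc_eval1 scale1r.
Qed.

Lemma vec_vJW s n v : (s + n <= 8)%N -> (n <= 4)%N ->
  JW s n (vec v) = vec (vJW s n v).
Proof.
elim: n v => [|[|n] IHn] v // le8 le4.
rewrite JWS Delta_ratio // IHn ?vec_vu ?IHn //; try by lia.
rewrite -[vJW s n.+2 v]/(vadd (vJW s n.+1 v) (vscale (cyc_scale (-1) (cyc_ratio n))
   (vJW s n.+1 (vu (s + n.+1) (vJW s n.+1 v))))).
by rewrite vecD vecZ eval_scale rmorphN rmorph1 mulN1r scaleNr.
Qed.

Lemma vec_vf2222 v : f2222 (vec v) = vec (vf2222 v).
Proof. by rewrite /f2222 !vec_vJW. Qed.

Lemma vec_vsigma j v : (0 < j < 8)%N -> sigma j (vec v) = vec (vsigma j v).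
Proof.
move=> j8; rewrite /sigma vec_vu // -eval_invA -vecZ.
have -> : A = cyc_eval R [:: 0; 1] by rewrite /= rmorph0 rmorph1; ring.
by rewrite -vecZ -vecD.
Qed.

Lemma vec_vrho i v : (0 < i < 4)%N -> rho R i (vec v) = vec (vrho i v).
Proof. by move=> i4; rewrite /rho !vec_vsigma //; lia. Qed.

Lemma pairing_linearr n (x : matching_space R n) :
  linear (pairing x : _ -> R[i]^o).
Proof.
move=> a y z; rewrite -[RHS]/(a * pairing x y + pairing x z).
rewrite /pairing mulr_sumr -big_split; apply: eq_bigr => m _.
rewrite mulr_sumr -big_split; apply: eq_bigr => m' _ /=.
by rewrite !ffunE /GRing.scale /=; ring.
Qed.

Lemma pairing_linearl n (x y z : matching_space R n) (a : R[i]) :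
  pairing (a *: x + y) z = a^* * pairing x z + pairing y z.
Proof.
rewrite /pairing mulr_sumr -big_split; apply: eq_bigr => m _.
rewrite mulr_sumr -big_split; apply: eq_bigr => m' _ /=.
by rewrite !ffunE /GRing.scale /= rmorphD rmorphM /=; ring.
Qed.

Lemma pairing_code n (a b : matching n) :
  pairing (diagram R n (matching_code a)) (diagram R n (matching_code b)) =
  delta R ^+ loops a b.
Proof.
rewrite /pairing (bigD1 a) //= [X in _ + X]big1 => [|m ma]; last first.
  by apply: big1 => m' _; rewrite diagram_code (negPf ma) rmorph0 !mul0r.
rewrite (bigD1 b) //= big1 => [|m mb]; last first.
  by rewrite (diagram_code _ b) (negPf mb) mulr0 mul0r.
by rewrite !diagram_code !eqxx rmorph1 !mul1r !addr0.
Qed.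

Lemma pairing_diagram8 s t : s \in codes8 -> t \in codes8 ->
  pairing (diagram R 8 s) (diagram R 8 t) = delta R ^+ loop_count s t.
Proof.
move=> sC tC; have /allP/(_ s sC)/allP/(_ t tC) := loop_label_invariant_codes8.
move: sC tC; rewrite codes8E => /matching_codesP[a <-] /matching_codesP[b <-] inv.
by rewrite pairing_code loops_code.
Qed.

Lemma eval_sum (L : M8 -> R[i]) F S v : linear (L : M8 -> R[i]^o) ->
    (forall s, s \in S -> L (diagram R 8 s) = cyc_eval R (F s)) ->
  L (lincomb S v) = cyc_eval R (cyc_sum F S v).
Proof.
move=> linL.
have L0 : L 0 = 0 := lin_map0 linL.
elim: S v => [|s S IHS] v Lf.
  by rewrite lincomb0 L0 /cyc_sum; case: v.
case: v => [|c v]; first by rewrite lincomb_nil L0.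
rewrite lincomb_cons linL Lf ?inE ?eqxx // IHS; last first.
  by move=> t tS; apply: Lf; rewrite inE tS orbT.
rewrite -[cyc_sum F (s :: S) _]/(cyc_add (cyc_mul c (F s)) (cyc_sum F S v)).
by rewrite eval_add eval_mul.
Qed.

Lemma pairing_vec v w : pairing (vec v) (vec w) = cyc_eval R (vpairing v w).
Proof.
have conjK (x : R[i]) : x^*^* = x by exact: conjCK.
pose L (x : M8) := (pairing x (vec w))^*.
have linL : linear (L : M8 -> R[i]^o).
  by move=> a x y; rewrite /L pairing_linearl rmorphD rmorphM /= conjK.
rewrite -[LHS]conjK -/(L (vec v)) /vec.
rewrite (eval_sum (F := fun s =>
    cyc_conj (cyc_sum (fun t => cyc_exp cyc_delta (loop_count s t)) codes8 w))) ?eval_conj //.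
move=> s sC; rewrite /L eval_conj; congr (_^*).
apply: eval_sum => [|t tC]; first exact: pairing_linearr.
by rewrite pairing_diagram8 // eval_exp eval_delta.
Qed.

End Vec.

(** * The fusion-tree basis and the braiding matrices *)

Definition vdiagram (s : seq nat) : seq (seq rat) := vunit [:: 1] (index s codes8).

(** The three matchings without an arc inside one of the pairs of points (1,2),
(3,4), (5,6), (7,8): all others are killed by the projectors. They join the
anyons 1 and 2 by two, one and no arcs respectively. *)
Definition double_nest : seq nat := [:: 3; 2; 1; 0; 7; 6; 5; 4].
Definition ring_matching : seq nat := [:: 7; 2; 1; 4; 3; 6; 5; 0].
Definition full_nest : seq nat := [:: 7; 6; 5; 4; 3; 2; 1; 0].

Definition vtree0 : seq (seq rat) := vf2222 (vdiagram double_nest).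
(** The f_2 on the bundle is the identity minus a multiple of the cup-cap, which
turns [ring_matching] into [double_nest]. *)
Definition vtree2 : seq (seq rat) :=
  vf2222 (vadd (vdiagram ring_matching)
    (vscale (cyc_scale (-1) (cyc_ratio 0)) (vdiagram double_nest))).
Definition vtree4 : seq (seq rat) := vf2222 (vJW 0 4 (vdiagram full_nest)).

Definition cyc_sqrt6 : seq rat := cyc_mul cyc_sqrt2 cyc_delta.

(** The squared norms of the three trees are 4, 2/3 and 1. *)
Definition vebasis : seq (seq (seq rat)) :=
  [:: vscale [:: 1 / 2] vtree0; vscale (cyc_scale (1 / 2) cyc_sqrt6) vtree2;
      vscale [:: 1] vtree4].

Definition vcomb (cs : seq (seq rat)) : seq (seq rat) :=
  foldr (fun p w => vadd (vscale p.1 p.2) w) [::] (zip cs vebasis).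

(** On [double_nest], [ring_matching] and [full_nest] the three trees have the
coefficients (1, 0, 0), (-delta/3, 1, 0) and (1/2, -delta, 1). This triangular
system, with the normalization, gives the coordinates in e_0, e_2, e_4 of a vector
of V_(4,2,0) from its coefficients a, b, c on these matchings. *)
Definition vcoords (w : seq (seq rat)) : seq (seq rat) :=
  let a := nth [::] w (index double_nest codes8) in
  let b := nth [::] w (index ring_matching codes8) in
  let c := nth [::] w (index full_nest codes8) in
  [:: cyc_add (cyc_scale 2 a)
        (cyc_add (cyc_mul (cyc_scale (2 / 3) cyc_delta) b) c);
      cyc_add (cyc_mul (cyc_scale (1 / 3) cyc_sqrt6) b) (cyc_mul cyc_sqrt2 c);
      c].

Definition cyc_t : seq rat := cyc_scale (1 / 2) [:: 0; 1; 0; 0; 0; 0; 0; 1].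

(** The scalar factor e^(i pi/9) of G_1 and G_2 does not lie in Q(A); it is the one
that part (2) removes. *)
Definition cyc_G1 : seq (seq (seq rat)) :=
  let a := cyc_scale 2 (cyc_mul (cyc_conj cyc_t) (cyc_conj cyc_t)) in
  let b := cyc_scale 2 (cyc_mul cyc_t cyc_t) in
  [:: [:: a; [::]; [::]]; [:: [::]; b; [::]]; [:: [::]; [::]; cyc_scale (-1) a]].

Definition cyc_G2 : seq (seq (seq rat)) :=
  let t := cyc_t in let t2 := cyc_mul t t in let mt2 := cyc_scale (-1) t2 in
  [:: [:: t2; t; mt2]; [:: t; [::]; t]; [:: mt2; t; t2]].

(** As the projectors are linear, this check on the basis of matchings is what
makes the trees span V_(4,2,0). *)
Lemma vspan_check : all (fun s =>
  let w := vf2222 (vdiagram s) in veq w (vcomb (vcoords w))) codes8.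
Proof. by vm_compute. Qed.

Lemma vortho_check : all (fun i => all (fun j =>
    cyc_eq (vpairing (nth [::] vebasis i) (nth [::] vebasis j))
      [:: (i == j)%:R]) (iota 0 3)) (iota 0 3).
Proof. by vm_compute. Qed.

Definition vmatrix_check r (M : seq (seq (seq rat))) :=
  all (fun j => veq (vrho r (nth [::] vebasis j))
                    (vcomb [seq nth [::] row j | row <- M])) (iota 0 3).

Lemma vrho1_check : vmatrix_check 1 cyc_G1.
Proof. by vm_compute. Qed.

Lemma vrho2_check : vmatrix_check 2 cyc_G2.
Proof. by vm_compute. Qed.

#[local] Opaque codes8 vdiagram vf2222 vJW vec diagram.

Section FusionTrees.
Variable R : realType.
Local Notation cyc_eval := (cyc_eval R).

Lemma vec_vdiagram s : s \in codes8 -> vec R (vdiagram s) = diagram R 8 s.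
Proof. by move=> sC; rewrite vec_vunit // cyc_eval1 scale1r. Qed.

Lemma cup_diagram_eq n a s t : s \in matching_codes n ->
    mkseq (cup_fun a (partner_of s)) n.+2 = t ->
  cup a (diagram R n s) = diagram R n.+2 t.
Proof. by move=> sC <-; rewrite cup_diagram. Qed.

Lemma empty_matching_diagram : empty_matching R = diagram R 0 [::].
Proof. exact: eq_basis_vec. Qed.

Lemma v0_vec : v0 R = vec R vtree0.
Proof.
rewrite /vtree0 -vec_vf2222 vec_vdiagram; last by vm_compute.
rewrite /v0 empty_matching_diagram; congr f2222.
rewrite (@cup_diagram_eq 0 0 _ [:: 1; 0]%N); [|by vm_compute..].
rewrite (@cup_diagram_eq 2 1 _ [:: 3; 2; 1; 0]%N); [|by vm_compute..].
rewrite (@cup_diagram_eq 4 4 _ [:: 3; 2; 1; 0; 5; 4]%N); [|by vm_compute..].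
by rewrite (@cup_diagram_eq 6 5 _ double_nest); [|vm_compute..].
Qed.

Lemma cup_diagram_comb n a c s t s' t' : s \in matching_codes n -> t \in matching_codes n ->
    mkseq (cup_fun a (partner_of s)) n.+2 = s' -> mkseq (cup_fun a (partner_of t)) n.+2 = t' ->
  cup a (diagram R n s + c *: diagram R n t) = diagram R n.+2 s' + c *: diagram R n.+2 t'.
Proof.
move=> sC tC es et; rewrite (lin_mapD (@cup_linear R n a)).
by rewrite (lin_mapZ (@cup_linear R n a)) (cup_diagram_eq sC es) (cup_diagram_eq tC et).
Qed.

Lemma vec_vf2222_comb c s t : s \in codes8 -> t \in codes8 ->
  vec R (vf2222 (vadd (vdiagram s) (vscale c (vdiagram t)))) =
  f2222 (diagram R 8 s + cyc_eval c *: diagram R 8 t).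
Proof. by move=> sC tC; rewrite -vec_vf2222 vecD vecZ !vec_vdiagram. Qed.

Lemma u_diagram_eq n j s t : s \in matching_codes n -> partner_of s j.-1 != j ->
  mkseq (cupcap_fun j.-1 (partner_of s)) n = t -> u_ j (diagram R n s) = diagram R n t.
Proof. by move=> sC /negPf sj <-; rewrite u_diagram // sj. Qed.

Lemma vec_vf2222_JW s : s \in codes8 ->
  vec R (vf2222 (vJW 0 4 (vdiagram s))) = f2222 (JW 0 4 (diagram R 8 s)).
Proof. by move=> sC; rewrite -vec_vf2222 -(vec_vJW R (s := 0) (n := 4)) ?vec_vdiagram. Qed.

Lemma v2_vec : v2 R = vec R vtree2.
Proof.
rewrite /vtree2 vec_vf2222_comb; [|by vm_compute..].
rewrite /v2 empty_matching_diagram; congr f2222.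
rewrite (@cup_diagram_eq 0 0 _ [:: 1; 0]%N) ; [|by vm_compute..].
rewrite (@cup_diagram_eq 2 1 _ [:: 3; 2; 1; 0]%N); [|by vm_compute..].
rewrite -[JW 0 2 _]/(diagram R 4 [:: 3; 2; 1; 0]%N
  - (Delta R 0 / Delta R 1) *: u_ 1 (diagram R 4 [:: 3; 2; 1; 0]%N)).
rewrite (@u_diagram_eq 4 1 _ [:: 1; 0; 3; 2]%N) -?scaleNr; [|by vm_compute..].
rewrite (@cup_diagram_comb 4 1 _ _ _ [:: 5; 2; 1; 4; 3; 0]%N [:: 3; 2; 1; 0; 5; 4]%N);
  [|by vm_compute..].
rewrite (@cup_diagram_comb 6 5 _ _ _ ring_matching double_nest); [|by vm_compute..].
by rewrite eval_scale rmorphN rmorph1 mulN1r -Delta_ratio.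
Qed.

Lemma v4_vec : v4 R = vec R vtree4.
Proof.
rewrite /vtree4 vec_vf2222_JW; last by vm_compute.
rewrite /v4 empty_matching_diagram; congr (f2222 (JW _ _ _)).
rewrite (@cup_diagram_eq 0 0 _ [:: 1; 0]%N); [|by vm_compute..].
rewrite (@cup_diagram_eq 2 1 _ [:: 3; 2; 1; 0]%N); [|by vm_compute..].
rewrite (@cup_diagram_eq 4 2 _ [:: 5; 4; 3; 2; 1; 0]%N); [|by vm_compute..].
by rewrite (@cup_diagram_eq 6 3 _ full_nest); [|vm_compute..].
Qed.

(** Normalization without taking roots in Q(A): it is enough to know an inverse y
of a nonnegative square root x of the squared norm. *)
Lemma normalize_vec v x y : cyc_eq (vpairing v v) (cyc_mul x x) -> 0 <= cyc_eval x ->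
  cyc_eq (cyc_mul y x) [:: 1] -> normalize (vec R v) = vec R (vscale y v).
Proof.
move=> /(cyc_eqP R) vx x0 /(cyc_eqP R); rewrite eval_mul cyc_eval1 => yx.
have xn0 : cyc_eval x != 0.
  by apply/eqP => x0'; move/eqP: yx; rewrite x0' mulr0 eq_sym oner_eq0.
rewrite /normalize pairing_vec vx eval_mul -expr2 sqrCK // vecZ.
by congr (_ *: _); apply: (mulIf xn0); rewrite yx mulVf.
Qed.

Lemma cyc_eval_nat n : cyc_eval [:: n%:R] = n%:R.
Proof. by rewrite /= mulr0 addr0 rmorph_nat. Qed.

Lemma sqrt6_third_ge0 : 0 <= cyc_eval (cyc_scale (1 / 3) cyc_sqrt6).
Proof.
rewrite eval_scale; apply: mulr_ge0; first by rewrite ler0q divr_ge0.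
rewrite /cyc_sqrt6 eval_mul eval_sqrt2; apply: mulr_ge0.
  by rewrite lecR sqrtr_ge0.
exact: cyc_delta_ge0.
Qed.

Lemma ebasis_vec (i : 'I_3) : ebasis R i = vec R (nth [::] vebasis i).
Proof.
rewrite /ebasis v0_vec v2_vec v4_vec.
case: i => [[|[|[|i]]] // lti] /=.
- apply: (@normalize_vec _ [:: 2]); [by vm_compute | | by vm_compute].
  by rewrite (cyc_eval_nat 2) ler0n.
- apply: (@normalize_vec _ (cyc_scale (1 / 3) cyc_sqrt6));
    [by vm_compute | exact: sqrt6_third_ge0 | by vm_compute].
- apply: (@normalize_vec _ [:: 1]); [by vm_compute | | by vm_compute].
  by rewrite (cyc_eval_nat 1) ler0n.
Qed.

Lemma vec_foldr n cs vs : size vs = n ->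
  vec R (foldr (fun p w => vadd (vscale p.1 p.2) w) [::] (zip cs vs)) =
  \sum_(i < n) cyc_eval (nth [::] cs i) *: vec R (nth [::] vs i).
Proof.
have v0 : vec R [::] = 0 by apply: lincomb_nil.
elim: vs n cs => [|v vs IHvs] [|n] // cs => [_|[szvs]].
  by rewrite big_ord0; case: cs => [|? ?].
rewrite big_ord_recl; case: cs => [|c cs] /=.
  by rewrite v0 scale0r add0r big1 // => i _; rewrite scale0r.
by rewrite vecD vecZ (IHvs n).
Qed.

Lemma vec_vcomb cs :
  vec R (vcomb cs) = \sum_(i < 3) cyc_eval (nth [::] cs i) *: ebasis R i.
Proof.
rewrite /vcomb (vec_foldr _ (n := 3)); last exact: erefl.
by apply: eq_bigr => i _; rewrite ebasis_vec.
Qed.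

Lemma f2222_linear : linear (@f2222 R).
Proof. by move=> a x y; rewrite /f2222 !JW_linear. Qed.

Lemma f2222_span x : exists c : 'I_3 -> R[i], f2222 x = \sum_i c i *: ebasis R i.
Proof.
pose w (m : matching 8) := vf2222 (vdiagram (matching_code m)).
exists (fun i => \sum_m x m * cyc_eval (nth [::] (vcoords (w m)) i)).
rewrite [in LHS](diagram_sum x) (lin_map_sum f2222_linear).
under [RHS]eq_bigr do rewrite scaler_suml.
rewrite exchange_big; apply: eq_bigr => m _ /=.
under [RHS]eq_bigr do rewrite -scalerA.
have mC : matching_code m \in codes8 by rewrite codes8E code_in_codes.
rewrite -scaler_sumr -vec_vcomb -(veqP R (allP vspan_check _ mC)) -vec_vf2222.
by rewrite vec_vdiagram // (lin_mapZ f2222_linear).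
Qed.

Lemma ebasis_orthonormal : orthonormal_basis (V420 R) (ebasis R).
Proof.
split=> [i|i j|x [y _ <-]]; last exact: f2222_span.
  rewrite /ebasis /normalize.
  by case: i => [[|[|[|i]]] // lti] /=; rewrite -(lin_mapZ f2222_linear); eexists.
have lt3 (k : 'I_3) : val k \in iota 0 3 by rewrite mem_iota /= ltn_ord.
have /allP/(_ _ (lt3 i))/allP/(_ _ (lt3 j)) := vortho_check.
by rewrite !ebasis_vec pairing_vec => /(cyc_eqP R) ->; rewrite cyc_eval_nat.
Qed.

Definition mx3_eval (M : seq (seq (seq rat))) : 'M[R[i]]_3 := mx3 (map (map cyc_eval) M).

Lemma mx3_evalE M (i j : 'I_3) : mx3_eval M i j = cyc_eval (nth [::] (nth [::] M i) j).
Proof.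
have nthe (T U : Type) (f : T -> U) d s k : nth (f d) (map f s) k = f (nth d s k).
  by elim: s k => [|x s IHs] [|k] //=.
by rewrite mxE -[[::]]/(map cyc_eval [::]) nthe -[0]/(cyc_eval [::]) nthe.
Qed.

Lemma rho_matrix r M : (0 < r < 4)%N -> vmatrix_check r M ->
  matrix_in_basis (rho R r) (ebasis R) (mx3_eval M).
Proof.
move=> r4 /allP chk j.
have /chk/(veqP R) e : val j \in iota 0 3 by rewrite mem_iota /= ltn_ord.
rewrite ebasis_vec vec_vrho // e vec_vcomb; apply: eq_bigr => i _; congr (_ *: _).
rewrite mx3_evalE; congr cyc_eval.
by elim: M (nat_of_ord i) {chk e} => [|row M IHM] [|k] //=; rewrite ?nth_nil.
Qed.

Lemma ev_tpar : cyc_eval cyc_t = tpar R.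
Proof.
rewrite tpar_Akauf eval_scale /= rmorphM fmorphV !rmorph_nat !rmorph0 rmorph1; ring.
Qed.

#[local] Opaque cyc_t.

Lemma eval_opp x : cyc_eval (cyc_scale (-1) x) = - cyc_eval x.
Proof. by rewrite eval_scale rmorphN rmorph1 mulN1r. Qed.

Lemma mx3_eval_G1 : mx3_eval cyc_G1 = expi (- pi / 9) *: G1 R.
Proof.
rewrite /G1 scalerA mulNr expiNK scale1r.
have -> a b c : mx3_eval [:: [:: a; [::]; [::]]; [:: [::]; b; [::]]; [:: [::]; [::]; c]] =
    diag3 (cyc_eval a) (cyc_eval b) (cyc_eval c) by [].
have ea : cyc_eval (cyc_scale 2 (cyc_mul (cyc_conj cyc_t) (cyc_conj cyc_t))) =
    2 * (tpar R)^* ^+ 2.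
  by rewrite eval_scale eval_mul eval_conj ev_tpar rmorph_nat expr2.
congr diag3; [exact: ea | | by rewrite eval_opp ea].
by rewrite eval_scale eval_mul ev_tpar rmorph_nat expr2.
Qed.

Lemma mx3_eval_G2 : mx3_eval cyc_G2 = expi (- pi / 9) *: G2 R.
Proof.
rewrite /G2 scalerA mulNr expiNK scale1r.
have -> a b c d : mx3_eval [:: [:: a; b; c]; [:: b; [::]; b]; [:: d; b; a]] =
    mx3 [:: [:: cyc_eval a; cyc_eval b; cyc_eval c];
            [:: cyc_eval b; 0; cyc_eval b];
            [:: cyc_eval d; cyc_eval b; cyc_eval a]] by [].
by rewrite eval_opp eval_mul ev_tpar expr2.
Qed.

End FusionTrees.

Unset Implicit Arguments.

Theorem theorem1 (R : realType) :
  (* G is a subgroup of SU(3) *)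
  [/\ SU3 R (G1 R), SU3 R (G2 R) & groupG R `<=` SU3 R] /\
  (* (1) *)
  [/\ eigenvalue (G1 R) =1 eigenvalue (G2 R),
      similar_in unitarymx (G2 R)
        (diag3 (expi (7 * pi / 9)) (- expi (4 * pi / 9)) (expi (- 2 * pi / 9))),
      has_order (G1 R) 18
    & has_order (G2 R) 18] /\
  (* (2) *)
  [/\ orthonormal_basis (V420 R) (ebasis R),
      matrix_in_basis (rho R 1) (ebasis R) (expi (- pi / 9) *: G1 R)
    & matrix_in_basis (rho R 2) (ebasis R) (expi (- pi / 9) *: G2 R)] /\
  (* (3) *)
  (G1 R * G2 R * G1 R = G2 R * G1 R * G2 R /\
   G1 R ^+ 2 * G2 R ^+ 2 = G2 R ^+ 2 * G1 R ^+ 2) /\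
  (* (4) *)
  [/\ is_normal_subgroup (groupG R) (groupN R),
      group_isomorphic *%R *%g (groupN R) [set: 'Z_9 * 'Z_3],
      is_subgroup (setH R) /\ setH R `<=` groupG R,
      group_isomorphic *%R *%g (setH R) [set: 'S_3]
    & is_semidirect_product (groupG R) (groupN R) (setH R)
        (fun H N => H * N * H^-1)] /\
  (* (5) *)
  group_isomorphic *%R *%R (groupG R) (D_group R 9 1 1 2 1 1).
Proof.
split; first by split; [exact: SU3_G1 | exact: SU3_G2 | exact: groupG_SU3].
split.
  split; [|exact: G2_similar|exact: order_G1|exact: order_G2].
  exact: eigenvalue_conj (unit_G12 R) (G2_conj R).
split.
  split; first exact: ebasis_orthonormal.
    by rewrite -mx3_eval_G1; exact: (@rho_matrix R 1 _ isT vrho1_check).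
  by rewrite -mx3_eval_G2; exact: (@rho_matrix R 2 _ isT vrho2_check).
split; first by split; [exact: braid_relation | exact: squares_commute].
split; last exact: groupG_D_group.
split.
- exact: groupN_normal.
- exact: groupN_isom.
- by split; [exact: setH_subgroup | exact: setH_sub].
- exact: setH_isom.
- exact: groupG_semidirect.
Qed.
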